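(* Let $I=[0,1]$, $y\in C(I)$, $1<\alpha\le 2$, and let $\lambda\in\mathbb{R}$ be such that $E_{\alpha,\alpha-1}(\lambda)\neq 0$. Then the problem $$D^{\alpha}u(t)-\lambda u(t)+y(t)=0,\quad t\in I,\qquad \lim_{t\to 0^+}t^{2-\alpha}u(t)=0,\quad u'(1)=0,$$ has a unique solution $u\in C^1_{2-\alpha}(I)=\{u:I\to\mathbb{R}\;:\; t^{2-\alpha}u(t)\in C^1(I)\}$, given by $$u(t)=\int_0^1 G(t,s)\,y(s)\,ds,$$ where $$G(t,s)=\begin{cases}\dfrac{t^{\alpha-1}E_{\alpha,\alpha}(\lambda t^\alpha)\,E_{\alpha,\alpha-1}(\lambda(1-s)^\alpha)}{(1-s)^{2-\alpha}E_{\alpha,\alpha-1}(\lambda)}-(t-s)^{\alpha-1}E_{\alpha,\alpha}(\lambda(t-s)^\alpha), & 0\le s\le t\le 1,\ s<1,\\[3mm] \dfrac{t^{\alpha-1}E_{\alpha,\alpha}(\lambda t^\alpha)\,E_{\alpha,\alpha-1}(\lambda(1-s)^\alpha)}{(1-s)^{2-\alpha}E_{\alpha,\alpha-1}(\lambda)}, & 0\le t<s<1.\end{cases}$$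
   Context: The two-parameter Mittag-Leffler function is $E_{\alpha,\beta}(x)=\sum_{k=0}^\infty \frac{x^k}{\Gamma(\alpha k+\beta)}$ for $\alpha,\beta>0$, $x\in\mathbb{R}$. $D^\alpha$ is the Riemann-Liouville fractional derivative with base point $0$: $D^\alpha f(t)=\frac{1}{\Gamma(n-\alpha)}\frac{d^n}{dt^n}\int_0^t (t-s)^{n-\alpha-1}f(s)\,ds$, $n=[\alpha]+1$ (for $\alpha=2$ it is the usual second derivative). Solutions may be singular at $t=0$: functions $u$ in $C^1_{2-\alpha}(I)$ are determined on $(0,1]$, the value of $t^{2-\alpha}u(t)$ at $t=0$ is its limit, and the differential equation is understood for $t>0$. *)

(* Defs.v *)
From mathcomp Require Import all_boot all_order all_algebra.
From mathcomp Require Import all_classical all_reals all_analysis.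

Set Implicit Arguments.
Unset Strict Implicit.
Unset Printing Implicit Defensive.

Import Order.TTheory GRing.Theory Num.Theory.
Import numFieldNormedType.Exports.

Local Open Scope classical_set_scope.
Local Open Scope ring_scope.

(* Euler's integral; it converges only for [0 < z]. *)
Definition Gamma (R : realType) (z : R) : R :=
  \int[lebesgue_measure]_(x in `]0, +oo[) (x `^ (z - 1) * expR (- x)).

Definition mittag_leffler (R : realType) (a b x : R) : R :=
  limn (series (fun k : nat => x ^+ k / Gamma (a * k%:R + b))).

(* Differentiation relative to a set [A] on which [f] is defined: two-sided at
   interior points of [A], one-sided at endpoints of an interval [A]. *)
Definition derivable_in (R : realType) (A : set R) (f : R -> R) (t : R) : Prop :=
  cvg ((f s - f t) / (s - t) @[s --> within A t^']).

Definition derive_in (R : realType) (A : set R) (f : R -> R) (t : R) : R :=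
  lim ((f s - f t) / (s - t) @[s --> within A t^']).

Definition C1_in (R : realType) (A : set R) (f : R -> R) : Prop :=
  (forall t, A t -> derivable_in A f t) /\
  {within A, continuous (derive_in A f)}.

(* Order [n = [a] + 1] of the outer derivative; [n = 3] when [a = 2]. *)
Definition RL_order (R : realType) (a : R) : nat := (Num.truncn a).+1.

Definition RL_integral (R : realType) (a : R) (f : R -> R) (t : R) : R :=
  (Gamma ((RL_order a)%:R - a))^-1 *
  \int[lebesgue_measure]_(s in `[0, t])
    ((t - s) `^ ((RL_order a)%:R - a - 1) * f s).

(* Riemann-Liouville derivative on [A] with base point 0.  It is meaningful only
   under [RL_derivable], since [derive_in] is a total function. *)
Definition RL_derive (R : realType) (A : set R) (a : R) (f : R -> R) : R -> R :=
  iter (RL_order a) (derive_in A) (RL_integral a f).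

Definition RL_derivable (R : realType) (A : set R) (a : R) (f : R -> R) : Prop :=
  forall (k : nat) (t : R), (k < RL_order a)%N -> A t ->
    derivable_in A (iter k (derive_in A) (RL_integral a f)) t.

(* [t `^ c * u t] is C^1 on [0, 1], its value at 0 being its limit there, i.e. the
   value of the C^1 extension [w]; [u 0] plays no role. *)
Definition C1_weighted (R : realType) (c : R) (u : R -> R) : Prop :=
  exists w : R -> R, C1_in `[0, 1] w /\
    (forall t, t \in `]0, 1] -> w t = t `^ c * u t).

Definition is_solution (R : realType) (a lambda : R) (y u : R -> R) : Prop :=
  [/\ C1_weighted (2 - a) u,
      RL_derivable `]0, 1] a u
        /\ (forall t, t \in `]0, 1] ->
              RL_derive `]0, 1] a u t - lambda * u t + y t = 0),
      t `^ (2 - a) * u t @[t --> 0^'+] --> 0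
    & derivable_in `]0, 1] u 1 /\ derive_in `]0, 1] u 1 = 0].

(* The value 0 on the null set [s = 1], where the kernel is not defined, is
   arbitrary. *)
Definition Green (R : realType) (a lambda t s : R) : R :=
  let E := @mittag_leffler R in
  let K := t `^ (a - 1) * E a a (lambda * t `^ a)
             * E a (a - 1) (lambda * (1 - s) `^ a)
           / ((1 - s) `^ (2 - a) * E a (a - 1) lambda) in
  if s < 1 then
    if s <= t then
      K - (t - s) `^ (a - 1) * E a a (lambda * (t - s) `^ a)
    else K
  else 0.

(* Main.v *)
(* Write k_a(x) = x^(a-1)/Gamma(a).  Evaluating Gamma(a) Gamma(b) as a double
   integral gives the Beta integral, that is k_a * k_b = k_(a+b) for the
   convolution on [0, 1].  Integrating the equation twice turns it into the
   Volterra equation V = c k_alpha + k_alpha * (lambda V - y): the condition at 0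
   kills the t^(alpha-2) term, and
   V'(1) = c k_(alpha-1)(1) + (k_(alpha-1) * (lambda V - y))(1).
   The function e_b(x) = x^(b-1) E_(alpha,b)(lambda x^alpha) satisfies
   e_b = k_b + lambda k_b * e_alpha term by term, hence c e_alpha - e_alpha * y
   solves the Volterra equation.  It is the only solution, because a difference D
   of two solutions satisfies D = lambda k_alpha * D, which iterates to
   |D| <= M |lambda|^n k_(n alpha + 1) -> 0.  Finally
   V'(1) = c e_(alpha-1)(1) - (e_(alpha-1) * y)(1) determines c, as
   e_(alpha-1)(1) = E_(alpha,alpha-1)(lambda) is not 0; substituting this c gives
   the Green function. *)

From HB Require Import structures.
Require Import Defs.
From mathcomp Require Import all_boot all_order all_algebra.
From mathcomp Require Import all_classical all_reals all_analysis.
From mathcomp Require Import measurable_realfun ring lra.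
Import Order.TTheory GRing.Theory Num.Theory.
Import numFieldNormedType.Exports.
Local Open Scope classical_set_scope.
Local Open Scope ring_scope.

(** For alpha < 2 the kernel k_(alpha-1) is unbounded at 0. Continuity of a convolution is therefore
    always taken from one continuous factor, the other being merely integrable, and a fractional
    integral is differentiated through k_(1+a) = k_1 * k_a and the fundamental theorem, never under
    the integral sign. Write g = lambda V - y. For alpha < 2, integrating the equation twice gives
    only k_(2-alpha) * V = c t + k_2 * g; convolving with k_(alpha-1) makes the left side k_1 * V,
    and differentiating recovers V (Abel inversion). For alpha = 2 the outer derivative has order 3
    and acts on k_1 * V, so this case is separate in both directions. Two solutions of the boundary
    value problem may come with different constants c, so uniqueness for a fixed c is not enough:
    the difference of the constants is removed by the condition at 1. *)

(** * The Gamma function and the Beta integral *)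

Section affine_change_of_variable.
Context {R : realType}.
Local Notation mu := (@lebesgue_measure R).
Variables (c d : R).
Hypothesis c_neq0 : c != 0.

Let phi : measurableTypeR R -> measurableTypeR R := fun x => c * x + d.

Let mphi : measurable_fun [set: measurableTypeR R] phi.
Proof.
by apply: measurable_funD => //; exact: measurable_funM.
Qed.

Let nc : {nonneg R} := NngNum (normr_ge0 c).

Let mu_phi : {measure set (measurableTypeR R) -> \bar R} :=
  measure_function_pushforward__canonical__measure_function_Measure mu mphi.

(** The right side is the scaled pushforward of [mu], so by uniqueness it suffices to compare
    half-open intervals. For [c < 0] the preimage of such an interval is closed on the other side,
    with the same length rule. *)
Lemma lebesgue_measure_affine (A : set R) : measurable A ->
  mu A = (`|c|%:E * mu ((fun x : R => (c * x + d)%R) @^-1` A))%E.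
Proof.
move=> mA.
pose m : {measure set (measurableTypeR R) -> \bar R} := mscale nc mu_phi.
rewrite (@lebesgue_measure_unique R m) //.
move=> _ [[a b] /= ab <-].
rewrite /m /= /mscale /= /pushforward.
have [c0|c0] := ltrP 0 c.
  rewrite (_ : phi @^-1` _ = `](a - d) / c, (b - d) / c]%classic); last first.
    apply/seteqP; split => x /=; rewrite !in_itv/=.
      by rewrite ltr_pdivrMr // ler_pdivlMr // ltrBlDr lerBrDr mulrC.
    by rewrite ltr_pdivrMr // ler_pdivlMr // ltrBlDr lerBrDr mulrC.
  rewrite !lebesgue_measure_itv/= !lte_fin ltr_pM2r ?invr_gt0// ltrD2r.
  case: ifPn => _; last by rewrite mule0.
  rewrite -!EFinD -EFinM; congr EFin.
  by rewrite gtr0_norm// -mulrBl mulrC divfK// opprB addrA subrK.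
have {}c0 : c < 0 by rewrite lt_neqAle c_neq0.
rewrite (_ : phi @^-1` _ = `[(b - d) / c, (a - d) / c[%classic); last first.
  apply/seteqP; split => x /=; rewrite !in_itv/=.
    by rewrite ltr_ndivlMr // ler_ndivrMr // ltrBlDr lerBrDr mulrC andbC.
  by rewrite ltr_ndivlMr // ler_ndivrMr // ltrBlDr lerBrDr mulrC andbC.
rewrite !lebesgue_measure_itv/= !lte_fin ltr_nM2r ?invr_lt0// ltrD2r.
case: ifPn => _; last by rewrite mule0.
rewrite -!EFinD -EFinM; congr EFin.
by rewrite ltr0_norm// -mulrBl mulNr mulrC divfK//; ring.
Qed.

Lemma ge0_integral_affine (f : R -> \bar R) : measurable_fun setT f ->
  (forall x, 0 <= f x)%E ->
  (\int[mu]_x f x = `|c|%:E * \int[mu]_x f (c * x + d)%R)%E.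
Proof.
move=> mf f0.
rewrite -(@ge0_integral_pushforward _ _ _ _ _ _ mphi mu setT f) //.
rewrite -(@ge0_integral_mscale _ _ _ mu_phi _ measurableT nc f mf)//.
apply: eq_measure_integral => /= A mA _.
by rewrite /mscale /= lebesgue_measure_affine.
Qed.

Lemma integral_affine (f : R -> \bar R) : measurable_fun setT f ->
  (\int[mu]_x f x = `|c|%:E * \int[mu]_x f (c * x + d)%R)%E.
Proof.
move=> mf; rewrite integralE [in RHS]integralE.
rewrite (_ : (fun x => f (c * x + d)%R)^\+%E = (fun x => f^\+%E (c * x + d)%R)); last first.
  by apply/funext => x; rewrite !funeposE.
rewrite (_ : (fun x => f (c * x + d)%R)^\-%E = (fun x => f^\-%E (c * x + d)%R)); last first.
  by apply/funext => x; rewrite !funenegE.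
rewrite ge0_integral_affine//; last exact: measurable_funepos.
rewrite [X in (_ - X)%E]ge0_integral_affine//; last exact: measurable_funeneg.
have c0 : (0 < `|c|%:E)%E by rewrite lte_fin normr_gt0.
set a := (\int[mu]_x f^\+ (c * x + d)%R)%E.
set b := (\int[mu]_x f^\- (c * x + d)%R)%E.
change (`|c|%:E * a - `|c|%:E * b = `|c|%:E * (a - b))%E.
(* [f] is only measurable, so the positive factor has to be distributed over differences of infinite
   values too. *)
case: a => [a||]; case: b => [b||];
  by rewrite ?(gt0_muley c0) ?(gt0_muleNy c0) //= -?EFinM -?EFinB -?EFinM
     ?mulrBr ?(gt0_muley c0) ?(gt0_muleNy c0).
Qed.

End affine_change_of_variable.

Lemma Rintegral_subl {R : realType} (f : R -> R) (t : R) :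
  measurable_fun setT f ->
  \int[lebesgue_measure]_s f (t - s) = \int[lebesgue_measure]_s f s.
Proof.
move=> mf; rewrite /Rintegral; congr fine.
rewrite [RHS](@integral_affine _ (-1) t) ?oppr_eq0//; last exact/measurable_EFinP.
by rewrite normrN1 mul1e; apply: eq_integral => x _; rewrite mulN1r addrC.
Qed.

Lemma integrable_subl {R : realType} (f : R -> R) (t : R) :
  lebesgue_measure.-integrable setT (EFin \o f) ->
  lebesgue_measure.-integrable setT (EFin \o (fun s => f (t - s))).
Proof.
move=> /integrableP[/measurable_EFinP mf fi]; apply/integrableP; split.
  by apply/measurable_EFinP; apply: measurableT_comp => //; exact: measurable_funB.
move: fi; rewrite (@ge0_integral_affine _ (-1) t) ?oppr_eq0//; last first.
  by apply: measurableT_comp => //; exact/measurable_EFinP.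
rewrite normrN1 mul1e; apply: le_lt_trans.
by rewrite le_eqVlt; apply/orP; left; apply/eqP; apply: eq_integral => x _ /=; rewrite mulN1r addrC.
Qed.

Section Gamma_function.
Context {R : realType}.
Local Notation mu := (@lebesgue_measure R).
Implicit Types (a b x t z : R).

Lemma measurable_powRl (a : R) (D : set R) : measurable_fun D (fun x => x `^ a).
Proof. by apply: measurable_funTS; exact: measurable_powR. Qed.

Lemma is_derive_powR a x : 0 < x ->
  is_derive x 1 (fun t => t `^ a) (a * x `^ (a - 1)).
Proof.
move=> x0.
have xI : x \in `]0, +oo[ by rewrite in_itv/= x0.
apply: DeriveDef; first exact: derivable_powR.
by rewrite -derive1E powR_derive1.
Qed.

Lemma continuous_powR a x : 0 < x -> {for x, continuous (fun t => t `^ a)}.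
Proof.
move=> x0; apply: differentiable_continuous.
apply/derivable1_diffP; exact: (@ex_derive _ _ _ _ _ _ _ (is_derive_powR a x x0)).
Qed.

Lemma integral_powR_itvcc a e : 0 < a -> 0 < e < 1 ->
  (\int[mu]_(x in `[e, 1%R]) (x `^ (a - 1))%:E = ((1 - e `^ a) / a)%:E)%E.
Proof.
move=> a0 /andP[e0 e1].
rewrite (@continuous_FTC2 _ _ (fun x => x `^ a / a))//.
- by rewrite powR1 mul1r -EFinB mulrBl mul1r.
- apply: continuous_in_subspaceT => x; rewrite inE/= in_itv/= => /andP[ex _].
  by apply: continuous_powR; exact: lt_le_trans ex.
- split.
  + move=> x; rewrite in_itv/= => /andP[ex _].
    have x0 := lt_trans e0 ex.
    apply: derivableM => //.
    exact: (@ex_derive _ _ _ _ _ _ _ (is_derive_powR a x x0)).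
  + apply: cvgMl; apply: cvg_at_right_filter; exact: continuous_powR.
  + apply: cvgMl; apply: cvg_at_left_filter; exact: continuous_powR.
- move=> x; rewrite in_itv/= => /andP[ex _].
  have x0 := lt_trans e0 ex.
  have H := is_derive_powR a x x0.
  rewrite derive1E deriveM// derive_cst scaler0 add0r.
  rewrite (@derive_val _ _ _ _ _ _ _ H).
  by rewrite /GRing.scale/= mulrA mulVf ?mul1r// gt_eqF.
Qed.

Lemma integral_powR_itvoc a : 0 < a ->
  (\int[mu]_(x in `]0%R, 1%R]) (x `^ (a - 1))%:E = (a^-1)%:E)%E.
Proof.
move=> a0.
(* The exponent may be negative, so []0, 1]] is exhausted by intervals away from 0; [n.+2] keeps the
   left end strictly below 1. *)
pose F (n : nat) : set R := `[n.+2%:R^-1, 1]%classic.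
have FU : \bigcup_n F n = `]0, 1]%classic.
  apply/seteqP; split => x /=.
    move=> [n _]; rewrite /F/= !in_itv/= => /andP[nx ->]; rewrite andbT.
    by apply: lt_le_trans nx; rewrite invr_gt0.
  rewrite in_itv/= => /andP[x0 x1].
  exists (Num.truncn x^-1) => //; rewrite /F/= in_itv/= x1 andbT.
  rewrite invf_ple ?posrE//.
  apply: ltW; apply: lt_trans (truncnS_gt _) _; by rewrite ltr_nat.
rewrite -FU.
have := @ge0_nondecreasing_set_cvg_integral _ (measurableTypeR R) R F (fun x => (x `^ (a - 1))%:E) mu.
move=> /(_ _ _ _ _)/cvg_lim <- //; last 4 first.
- apply/nondecreasing_seqP => n; apply/subsetPset => x; rewrite /F/= !in_itv/=.
  move=> /andP[nx ->]; rewrite andbT; apply: le_trans nx.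
  by rewrite lef_pV2 ?posrE// ler_nat.
- by move=> n; exact: measurable_itv.
- by move=> n; apply/measurable_EFinP; exact: measurable_powRl.
- by move=> n x _; rewrite lee_fin powR_ge0.
apply/cvg_lim => //.
have -> : (fun n => (\int[mu]_(x in F n) (x `^ (a - 1))%:E)%E) =
    (fun n => ((1 - n.+2%:R^-1 `^ a) / a)%:E).
  apply/funext => n; rewrite integral_powR_itvcc// invr_gt0 ltr0n/=.
  by rewrite invf_lt1 ?ltr1n.
apply: cvg_EFin; first exact: nearW.
have -> : fine \o (fun n : nat => ((1 - n.+2%:R^-1 `^ a) / a)%:E) =
  (fun n : nat => (1 - n.+2%:R^-1 `^ a) / a) by [].
rewrite [X in _ --> X](_ : _ = (1 - 0) / a); last by rewrite subr0 mul1r.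
apply: cvgMl; apply: cvgB; first exact: cvg_cst.
have /cvg_at_rightP := powR_cvg0 a0.
apply; split => [n|]; first by rewrite invr_gt0.
have := @cvg_harmonic R; rewrite -(cvg_shiftS (@harmonic R)); exact.
Qed.

Lemma integrable_Gamma z : 0 < z ->
  mu.-integrable `]0, +oo[ (fun x => (x `^ (z - 1) * expR (- x))%:E).
Proof.
move=> z0.
(* For x > 1, x^(z-1) <= x^z, and raising x <= 2z exp(x/(2z)) to the power z gives x^z <= C
   exp(x/2). The density [g2] is exp(-x/2)/2, whence the factor [2 * C] below. *)
pose C := (2 * z) `^ z.
have C0 : 0 <= C by exact: powR_ge0.
pose g1 := (fun x => x `^ (z - 1)) \_ `]0, 1].
pose g2 := exponential_pdf (2^-1 : R).
have g10 x : 0 <= g1 x by rewrite /g1 patchE; case: ifP => // _; exact: powR_ge0.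
have g20 x : 0 <= g2 x by apply: exponential_pdf_ge0; rewrite invr_ge0.
have i1 : mu.-integrable `]0, +oo[ (EFin \o g1).
  apply: (@integrableS _ _ _ _ setT) => //.
  rewrite -restrict_EFin; apply/integrable_restrict => //.
  rewrite setTI; apply/integrableP; split.
    by apply/measurable_EFinP; exact: measurable_powRl.
  under eq_integral do rewrite /= ger0_norm ?powR_ge0//.
  by rewrite integral_powR_itvoc// ltry.
have i2 : mu.-integrable `]0, +oo[ (fun x => (2 * C)%:E * (g2 x)%:E)%E.
  apply: integrableZl => //.
  apply: (@integrableS _ _ _ _ setT) => //.
  exact: integrable_exponential_pdf.
apply: (le_integrable _ _ _ (integrableD _ i1 i2)) => //.
  apply/measurable_EFinP; apply: measurable_funM; first exact: measurable_powRl.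
  by apply: measurableT_comp => //; exact: measurable_funTS.
move=> x /=; rewrite in_itv/= andbT => x0.
rewrite !ger0_norm; last 2 first.
  by rewrite addr_ge0// mulr_ge0// mulr_ge0.
  by rewrite mulr_ge0 ?powR_ge0 ?expR_ge0.
rewrite lee_fin.
have [x1|x1] := leP x 1.
  rewrite /g1 patchE mem_set/=; last by rewrite in_itv/= x0.
  rewrite -[leLHS]addr0 lerD//; last by rewrite mulr_ge0// mulr_ge0.
  by rewrite ler_piMr ?powR_ge0// -expR0 ler_expR oppr_le0 ltW.
apply: ler_wpDl => //.
rewrite /g2 /exponential_pdf patchE mem_set/=; last by rewrite in_itv/= ltW.
rewrite mulrA [2 * C]mulrC mulfK//.
have -> : expR (- x) = expR (- (x / 2)) * expR (- 2^-1 * x).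
  by rewrite -expRD; congr expR; field.
rewrite mulrA ler_wpM2r ?expR_ge0//.
rewrite expRN ler_pdivrMr ?expR_gt0//.
apply: (@le_trans _ _ (x `^ z)); first by apply: ler_powR; [exact: ltW|lra].
have -> : expR (x / 2) = expR (x / (2 * z)) `^ z.
  by rewrite -expRM; congr expR; field; rewrite gt_eqF.
rewrite /C -powRM ?expR_ge0//; last by lra.
apply: ge0_ler_powR; rewrite ?nnegrE; [lra|lra|by rewrite mulr_ge0 ?expR_ge0//; lra|].
have : x / (2 * z) <= expR (x / (2 * z)).
  by apply: le_trans (expR_ge1Dx _); rewrite lerDr.
rewrite ler_pdivrMr; last lra.
by rewrite mulrC.
Qed.

Lemma EFin_Gamma z : 0 < z ->
  (Gamma z)%:E = (\int[mu]_(x in `]0%R, +oo[) (x `^ (z - 1) * expR (- x))%:E)%E.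
Proof.
move=> z0; rewrite fineK//.
apply: integrable_fin_num; first exact: measurable_itv.
exact: integrable_Gamma.
Qed.

Lemma integral_gt0_itv (f : R -> R) a b (D : set R) : 
  measurable D -> measurable_fun D f -> (forall x, D x -> 0 <= f x) ->
  `]a, b] `<=` D -> a < b ->
  forall m, 0 < m -> (forall x, `]a, b]%classic x -> m <= f x) ->
  ((m * (b - a))%:E <= \int[mu]_(x in D) (f x)%:E)%E.
Proof.
move=> mD mf f0 abD ab m m0 mfx.
apply: (@le_trans _ _ (\int[mu]_(x in `]a, b]) (f x)%:E)%E); last first.
  by apply: ge0_subset_integral => //; exact/measurable_EFinP.
apply: (@le_trans _ _ (\int[mu]_(x in `]a, b]) (m%:E))%E); last first.
  apply: ge0_le_integral => //; first by move=> x _; rewrite lee_fin ltW.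
  - by apply/measurable_EFinP; exact: measurable_funS mf.
rewrite integral_cst//= lebesgue_measure_itv/= lte_fin ab.
by rewrite -EFinD -EFinM.
Qed.

(** Only the strip []A, A + 1]] of Euler's integral is kept. As [A] is free, Gamma outgrows every
    geometric sequence, which is what makes the Mittag-Leffler series converge. *)
Lemma Gamma_ge A z : 0 < A -> 1 <= z -> A `^ (z - 1) * expR (- A - 1) <= Gamma z.
Proof.
move=> A0 z1; have z0 : 0 < z by exact: lt_le_trans z1.
rewrite -lee_fin EFin_Gamma//.
have := @integral_gt0_itv (fun x => x `^ (z - 1) * expR (- x)) A (A + 1) `]0, +oo[.
move=> /(_ _ _ _ _ _ (A `^ (z - 1) * expR (- A - 1)) _).
rewrite (addrC A) addrK mulr1; apply.
- by [].
- apply: measurable_funM; first exact: measurable_powRl.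
  by apply: measurableT_comp => //; exact: measurable_funTS.
- by move=> x _; rewrite mulr_ge0 ?powR_ge0 ?expR_ge0.
- by move=> x /=; rewrite !in_itv/= andbT => /andP[Ax _]; exact: lt_trans Ax.
- by rewrite ltrDr.
- by rewrite mulr_gt0 ?powR_gt0 ?expR_gt0.
- move=> x /=; rewrite in_itv/= => /andP[Ax xA].
  apply: ler_pM; rewrite ?powR_ge0 ?expR_ge0//.
    apply: ge0_ler_powR; rewrite ?nnegrE ?subr_ge0//; [exact: ltW| |exact: ltW].
    by rewrite ltW// (lt_trans A0).
  by rewrite ler_expR; lra.
Qed.

Lemma Gamma_gt0 z : 0 < z -> 0 < Gamma z.
Proof.
move=> z0; rewrite -lte_fin EFin_Gamma//.
(* On []1, 2]] the power is at least 1 or at least 2^(z-1), according to the sign of z - 1. *)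
pose m := Num.min 1 (2 `^ (z - 1)) * expR (-2).
have m0 : 0 < m by rewrite mulr_gt0 ?expR_gt0// lt_min ltr01 powR_gt0.
apply: lt_le_trans (@integral_gt0_itv (fun x => x `^ (z - 1) * expR (- x)) 1 2
  `]0, +oo[ _ _ _ _ _ m _ _) => //.
- by rewrite lte_fin mulr_gt0//; lra.
- apply: measurable_funM; first exact: measurable_powRl.
  by apply: measurableT_comp => //; exact: measurable_funTS.
- by move=> x _; rewrite mulr_ge0 ?powR_ge0 ?expR_ge0.
- by move=> x /=; rewrite !in_itv/= andbT => /andP[Ax _]; exact: lt_trans Ax.
- by lra.
- move=> x /=; rewrite in_itv/= => /andP[x1 x2].
  apply: ler_pM; rewrite ?expR_ge0//.
  + rewrite ge_min; have [z1|z1] := leP 1 z.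
      apply/orP; left; rewrite -[X in X <= _](powRr0 x); apply: ler_powR; first exact: ltW.
      by rewrite subr_ge0.
    apply/orP; right.
    have -> : z - 1 = - (1 - z) by lra.
    rewrite !powRN lef_pV2 ?posrE ?powR_gt0//; last by rewrite (lt_trans _ x1).
    apply: ge0_ler_powR; rewrite ?nnegrE//; lra.
  + by rewrite ler_expR; lra.
Qed.

Lemma Gamma1 : Gamma (1 : R) = 1.
Proof.
apply: EFin_inj; rewrite EFin_Gamma// subrr -(integral_exponential_pdf (ltr01 : 0 < 1 :> R)).
rewrite integral_itv_obnd_cbnd; last first.
  apply/measurable_EFinP; apply: measurable_funM; first exact: measurable_powRl.
  by apply: measurableT_comp => //; exact: measurable_funTS.
rewrite integral_mkcond; apply: eq_integral => x _.
rewrite /exponential_pdf !patchE; case: ifP => //= _.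
by rewrite powRr0 !mul1r mulN1r.
Qed.

End Gamma_function.

Lemma measurable_patch_itv {R : realType} (i : interval R) (f : R -> R) :
  measurable_fun setT f -> measurable_fun setT (f \_ [set` i]).
Proof.
by move=> mf; apply: (measurable_restrictT f (measurable_itv i)).1; exact: measurable_funTS.
Qed.

Section beta_integral.
Context {R : realType}.
Local Notation mu := (@lebesgue_measure R).
Implicit Types (a b x t z : R).

(** Extension by 0 turns the Gamma and Beta integrals into integrals over the whole line, where
    substitution and Tonelli need no bookkeeping of domains. *)
Let pow a : R -> R := locked ((fun x => x `^ (a - 1)) \_ `]0, +oo[).

Let pow_gt0 a x : 0 < x -> pow a x = x `^ (a - 1).
Proof. by move=> x0; rewrite /pow -lock patchE mem_set//= in_itv/= x0. Qed.

Let pow_le0 a x : x <= 0 -> pow a x = 0.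
Proof.
move=> x0; rewrite /pow -lock patchE memNset//= in_itv/= andbT.
by apply/negP; rewrite -leNgt.
Qed.

Let pow_ge0 a x : 0 <= pow a x.
Proof.
by have [x0|x0] := leP x 0; [rewrite pow_le0|rewrite pow_gt0// powR_ge0].
Qed.

Let mpow a : measurable_fun setT (pow a).
Proof. by rewrite /pow -lock; apply: measurable_patch_itv; exact: measurable_powRl. Qed.

Let powM a x s : 0 < x -> pow a (x * s) = x `^ (a - 1) * pow a s.
Proof.
move=> x0; have [s0|s0] := leP s 0.
  by rewrite !pow_le0 ?mulr0// mulr_ge0_le0// ltW.
by rewrite !pow_gt0 ?mulr_gt0// powRM// ltW.
Qed.

Let mpow1 a b x : measurable_fun setT (fun s : R => pow a (x - s) * pow b s).
Proof.
apply: measurable_funM; last exact: mpow.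
by apply: (measurableT_comp (mpow a)); exact: measurable_funB.
Qed.

Let beta a b := (\int[mu]_s (pow a (1 - s) * pow b s)%:E)%E.

Let integral_pow_scale a b x : 0 < x ->
  (\int[mu]_s (pow a (x - s) * pow b s)%:E = (x `^ (a + b - 1))%:E * beta a b)%E.
Proof.
move=> x0.
rewrite (@ge0_integral_affine _ x 0 (lt0r_neq0 x0)); last 2 first.
- by apply/measurable_EFinP; exact: mpow1.
- by move=> s; rewrite lee_fin mulr_ge0.
rewrite gtr0_norm//.
under eq_integral => s _.
  rewrite addr0 -[X in pow a (X - _)](mulr1 x) -mulrBr !powM// mulrACA EFinM.
  over.
rewrite /= ge0_integralZl; first last.
- by rewrite lee_fin mulr_ge0 ?powR_ge0.
- by move=> s _; rewrite lee_fin mulr_ge0.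
- by apply/measurable_EFinP; exact: mpow1.
- exact: measurableT.
rewrite muleA -EFinM; congr (_%:E * _)%E.
rewrite -powRD ?(gt_eqF x0) ?implybT// -{1}(powRr1 (ltW x0)).
rewrite -powRD ?(gt_eqF x0) ?implybT//; congr (_ `^ _); ring.
Qed.

Let gam a : R -> R := locked (fun x => pow a x * expR (- x)).

Let gamE a x : gam a x = pow a x * expR (- x).
Proof. by rewrite /gam -lock. Qed.

Let mgam a : measurable_fun setT (gam a).
Proof.
rewrite /gam -lock; apply: measurable_funM; first exact: mpow.
by apply: measurableT_comp; [exact: measurable_expR|exact: measurable_funN].
Qed.

Let gam_ge0 a x : 0 <= gam a x.
Proof. by rewrite gamE mulr_ge0// expR_ge0. Qed.

Let integral_gam a : 0 < a -> (\int[mu]_x (gam a x)%:E = (Gamma a)%:E)%E.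
Proof.
move=> a0; rewrite EFin_Gamma// [RHS]integral_mkcond.
apply: eq_integral => x _; rewrite gamE /pow -lock !patchE.
by case: ifP => //; rewrite mul0r.
Qed.

(** The product of the two exponentials is exp(-x), which does not depend on s; what remains is a
    rescaled Beta integral. *)
Let integral_gam_conv a b x : 
  (\int[mu]_s (gam a (x - s) * gam b s)%:E = (gam (a + b) x)%:E * beta a b)%E.
Proof.
have E s : gam a (x - s) * gam b s = expR (- x) * (pow a (x - s) * pow b s).
  have -> : expR (- x) = expR (- (x - s)) * expR (- s).
    by rewrite -expRD; congr expR; ring.
  by rewrite !gamE; ring.
under eq_integral do rewrite E EFinM.
rewrite ge0_integralZl; first last.
- by rewrite lee_fin expR_ge0.
- by move=> s _; rewrite lee_fin mulr_ge0.
- by apply/measurable_EFinP; exact: mpow1.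
- exact: measurableT.
have [x0|x0] := leP x 0.
  rewrite gamE pow_le0// mul0r mul0e integral0_eq ?mule0// => s _.
  have [s0|s0] := leP s 0; first by rewrite (pow_le0 b)// mulr0.
  by rewrite pow_le0 ?mul0r//; lra.
by rewrite integral_pow_scale// muleA -EFinM gamE pow_gt0// mulrC.
Qed.

Let Gamma_beta a b : 0 < a -> 0 < b ->
  ((Gamma a * Gamma b)%:E = (Gamma (a + b))%:E * beta a b)%E.
Proof.
move=> a0 b0; have ab0 : 0 < a + b by exact: addr_gt0.
pose f (z : R * R) := (gam a (z.1 - z.2) * gam b z.2)%:E.
have mf : measurable_fun setT f.
  apply/measurable_EFinP; apply: measurable_funM; last exact: (measurableT_comp (mgam b)).
  by apply: (measurableT_comp (mgam a)); exact: measurable_funB.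
have f0 (z : R * R) : (0 <= f z)%E by rewrite lee_fin mulr_ge0.
have mEgam c : measurable_fun setT (EFin \o gam c).
  by apply/measurable_EFinP; exact: mgam.
have beta0 : (0 <= beta a b)%E.
  by apply: integral_ge0 => s _; rewrite lee_fin mulr_ge0.
transitivity (\int[mu]_x \int[mu]_s f (x, s))%E; last first.
  under eq_integral => x _ do rewrite /f /= integral_gam_conv muleC.
  rewrite ge0_integralZl; first last.
  - exact: beta0.
  - by move=> x _; rewrite lee_fin.
  - exact: mEgam.
  - exact: measurableT.
  by rewrite integral_gam// muleC.
rewrite (@fubini_tonelli _ _ (measurableTypeR R) (measurableTypeR R) R mu mu f mf f0).
under eq_integral => s _.
  rewrite /f /=; under eq_integral do rewrite mulrC EFinM.
  rewrite ge0_integralZl; first last.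
  - by rewrite lee_fin.
  - by move=> x _; rewrite lee_fin.
  - apply/measurable_EFinP; apply: (measurableT_comp (mgam a)); exact: measurable_funB.
  - exact: measurableT.
  have -> : (\int[mu]_x (gam a (x - s))%:E = (Gamma a)%:E)%E.
    rewrite -integral_gam// [RHS](@ge0_integral_affine _ 1 (- s) (oner_neq0 _)); last 2 first.
    - exact: mEgam.
    - by move=> x; rewrite lee_fin.
    by rewrite normr1 mul1e; apply: eq_integral => x _; rewrite mul1r.
  rewrite muleC; over.
rewrite /= ge0_integralZl; first last.
- by rewrite lee_fin ltW// Gamma_gt0.
- by move=> x _; rewrite lee_fin.
- exact: mEgam.
- exact: measurableT.
by rewrite integral_gam// -EFinM.
Qed.

Lemma integral_betaE a b x : 0 < a -> 0 < b -> 0 < x ->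
  (\int[mu]_(s in `]0%R, x[) ((x - s) `^ (a - 1) * s `^ (b - 1))%:E =
   (Gamma a * Gamma b / Gamma (a + b) * x `^ (a + b - 1))%:E)%E.
Proof.
move=> a0 b0 x0; have ab0 : 0 < a + b by exact: addr_gt0.
have G0 := Gamma_gt0 _ ab0.
transitivity (\int[mu]_s (pow a (x - s) * pow b s)%:E)%E.
  rewrite integral_mkcond; apply: eq_integral => s _; rewrite patchE.
  case: ifPn => [|/negP]; rewrite inE/= in_itv/=.
    by move=> /andP[s0 sx]; rewrite !pow_gt0// subr_gt0.
  move=> /negP; rewrite negb_and -!leNgt => /orP[s0|xs].
    by rewrite (pow_le0 b)// mulr0.
  by rewrite pow_le0 ?mul0r// subr_le0.
rewrite integral_pow_scale// [X in _ = X]EFinM muleC; congr (_ * _)%E.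
(* The finiteness of [beta] is only obtained here: an infinite value would make the finite product
   of the two Gamma values infinite. *)
have := Gamma_beta a b a0 b0; case: (beta a b) => [r| |].
- by rewrite -EFinM => -[->]; rewrite mulrAC divff ?mul1r// gt_eqF.
- by rewrite gt0_muley.
- by rewrite gt0_muleNy.
Qed.

(** With first parameter 1 the Beta integral is that of s^(a-1) over []0, 1[], which is 1/a; this
    replaces the integration by parts. *)
Lemma GammaS a : 0 < a -> Gamma (1 + a) = a * Gamma a.
Proof.
move=> a0; have := integral_betaE 1 a 1 ltr01 a0 ltr01.
rewrite powR1 Gamma1 mul1r mulr1.
under eq_integral do rewrite subrr powRr0 mul1r.
rewrite integral_itv_bndo_bndc; last first.
  by apply/measurable_EFinP; exact: measurable_powRl.
rewrite integral_powR_itvoc// => aVE; have aV := EFin_inj aVE.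
have G0 := Gamma_gt0 _ (addr_gt0 ltr01 a0).
rewrite -[Gamma a](@divfK _ (Gamma (1 + a))) ?gt_eqF// -aV mulrA divff ?mul1r//.
by rewrite gt_eqF.
Qed.

End beta_integral.

(** * Convolution with power kernels *)

(* Otherwise comparing [Gamma a] with [Gamma b] unfolds both integrals. *)
Local Opaque Gamma.

Section convolution.
Context {R : realType}.
Local Notation mu := (@lebesgue_measure R).
Local Notation intg f := (mu.-integrable [set: R] (EFin \o f)).
Implicit Types (f g h k : R -> R) (a b x t s M : R).

(** When both factors vanish for nonpositive arguments this is the integral over [0, t]. *)
Definition conv f g t := \int[mu]_s (f (t - s) * g s).

Lemma measurable_intg f : intg f -> measurable_fun setT f.
Proof. by move=> /integrableP[/measurable_EFinP]. Qed.

Lemma intgM_bounded f h M : intg f -> measurable_fun setT h ->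
  (forall x, `|h x| <= M) -> intg (fun s => f s * h s).
Proof.
move=> fi mh hM.
have iM : mu.-integrable [set: R] (fun x => M%:E * (EFin \o f) x)%E.
  exact: integrableZl.
apply: (le_integrable measurableT _ _ iM).
  apply/measurable_EFinP; apply: measurable_funM => //; exact: measurable_intg.
move=> x _; rewrite /comp -EFinM !abse_EFin lee_fin !normrM mulrC ler_wpM2r//.
by apply: le_trans (hM x) _; exact: ler_norm.
Qed.

Lemma integrable_conv f h M t : intg f -> measurable_fun setT h ->
  (forall x, `|h x| <= M) -> intg (fun s => f (t - s) * h s).
Proof. by move=> fi; exact/intgM_bounded/integrable_subl. Qed.

Lemma conv_Zr f g a t : intg (fun s => f (t - s) * g s) ->
  conv f (fun s => a * g s) t = a * conv f g t.
Proof.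
move=> i; rewrite /conv -RintegralZl//; apply: eq_Rintegral => s _.
by rewrite mulrCA.
Qed.

Lemma conv_Dr f g h t : intg (fun s => f (t - s) * g s) ->
  intg (fun s => f (t - s) * h s) ->
  conv f (fun s => g s + h s) t = conv f g t + conv f h t.
Proof.
move=> ig ih; rewrite /conv -RintegralD//; apply: eq_Rintegral => s _.
by rewrite mulrDr.
Qed.

Lemma conv_Zl f g a t : intg (fun s => f (t - s) * g s) ->
  conv (fun s => a * f s) g t = a * conv f g t.
Proof.
move=> i; rewrite /conv -RintegralZl//; apply: eq_Rintegral => s _.
by rewrite mulrA.
Qed.

Lemma conv_Dl f g h t : intg (fun s => f (t - s) * h s) ->
  intg (fun s => g (t - s) * h s) ->
  conv (fun s => f s + g s) h t = conv f h t + conv g h t.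
Proof.
move=> ig ih; rewrite /conv -RintegralD//; apply: eq_Rintegral => s _.
by rewrite mulrDl.
Qed.

Lemma convC f g t : measurable_fun setT f -> measurable_fun setT g ->
  conv f g t = conv g f t.
Proof.
move=> mf mg; rewrite /conv -(Rintegral_subl _ t); last first.
  apply: measurable_funM => //.
  by apply: (measurableT_comp mf); exact: measurable_funB.
by apply: eq_Rintegral => s _; rewrite opprB addrC subrK mulrC.
Qed.

Lemma conv_le0 f g t : (forall x, x <= 0 -> f x = 0) ->
  (forall x, x <= 0 -> g x = 0) -> t <= 0 -> conv f g t = 0.
Proof.
move=> f0 g0 t0; rewrite /conv; transitivity (\int[mu]_(s in [set: R]) 0).
  apply: eq_Rintegral => s _; have [s0|s0] := leP s 0; first by rewrite g0 ?mulr0.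
  by rewrite f0 ?mul0r//; lra.
by rewrite Rintegral_cst// mul0r.
Qed.

Lemma eq_conv f g1 g2 t : (forall x, x <= 0 -> f x = 0) ->
  (forall s, s < t -> g1 s = g2 s) -> conv f g1 t = conv f g2 t.
Proof.
move=> f0 g12; apply: eq_Rintegral => s _.
have [ts|st] := leP t s; first by rewrite f0 ?mul0r// subr_le0.
by rewrite g12.
Qed.

Lemma eq_convl f1 f2 g t : (forall x, x <= 0 -> g x = 0) ->
  (forall s, s < t -> f1 s = f2 s) -> conv f1 g t = conv f2 g t.
Proof.
move=> g0 f12; apply: eq_Rintegral => s _.
have [s0|s0] := leP s 0; first by rewrite g0 ?mulr0.
by rewrite f12// ltrBlDr ltrDl.
Qed.

(* Convolutions are only evaluated on [0, 1]; cutting the factors off outside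
   ]0, 1] changes no value there and makes every kernel integrable on R. *)
Definition on01 f : R -> R := f \_ `]0, 1].

Lemma on01E f x : 0 < x <= 1 -> on01 f x = f x.
Proof. by move=> x01; rewrite /on01 patchE mem_set. Qed.

Lemma on01_le0 f x : x <= 0 -> on01 f x = 0.
Proof.
move=> x0; rewrite /on01 patchE memNset//= in_itv/= => /andP[].
by rewrite ltNge x0.
Qed.

Lemma on01_gt1 f x : 1 < x -> on01 f x = 0.
Proof.
move=> x1; rewrite /on01 patchE memNset//= in_itv/= => /andP[_].
by rewrite leNgt x1.
Qed.

Lemma on01_id f : (forall x, x <= 0 -> f x = 0) -> forall x, x <= 1 -> on01 f x = f x.
Proof.
move=> f0 x x1; have [x0|x0] := leP x 0; first by rewrite on01_le0 ?f0.
by rewrite on01E// x0.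
Qed.

Lemma conv_on01 f g t : (forall x, x <= 0 -> f x = 0) ->
  (forall x, x <= 0 -> g x = 0) -> t <= 1 -> conv f (on01 g) t = conv f g t.
Proof.
move=> f0 g0 t1; apply: eq_conv => // s st; apply: on01_id => //.
by rewrite (le_trans (ltW st)).
Qed.

Lemma on01P f (P : R -> Prop) : P 0 -> (forall x, 0 < x <= 1 -> P (f x)) ->
  forall x, P (on01 f x).
Proof.
move=> P0 Pf x; rewrite /on01 patchE; case: ifPn => // /set_mem/=.
by rewrite in_itv/= => /Pf.
Qed.

Lemma measurable_on01 f : measurable_fun (`]0, 1] : set R) f -> measurable_fun setT (on01 f).
Proof. by apply: (measurable_restrictT f (measurable_itv _)).1. Qed.

Lemma intg_on01_bounded f M : measurable_fun (`]0, 1] : set R) f ->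
  (forall x, 0 < x <= 1 -> `|f x| <= M) -> intg (on01 f).
Proof.
move=> mf fM; rewrite /on01 -restrict_EFin.
apply/integrable_restrict => //; rewrite setTI.
apply: measurable_bounded_integrable => //.
  by rewrite /= lebesgue_measure_itv/= lte_fin ltr01 -EFinD ltry.
exists M; split; first exact: num_real.
by move=> m Mm x /=; rewrite in_itv/= => /fM /le_trans; apply; exact: ltW.
Qed.

(** Fubini for f(t-s) g(s-r) h(r), dominated by M times the product without h, which Tonelli
    integrates. The convolution of two integrable functions need not converge at every point, hence
    the last hypothesis; it is restricted to [h r != 0] because for power kernels it is available
    only at arguments at most 1. *)
Lemma convA f g h M t :
  intg f -> intg g -> measurable_fun setT h -> (forall x, `|h x| <= M) ->
  (forall r, h r != 0 -> intg (fun s => f (t - r - s) * g s)) ->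
  conv f (conv g h) t = conv (conv f g) h t.
Proof.
move=> fi gi mh hM fgi.
have mf := measurable_intg _ fi; have mg := measurable_intg _ gi.
have M0 : 0 <= M by exact: le_trans (hM 0).
pose H (z : R * R) := (f (t - z.1) * g (z.1 - z.2))%:E.
have mH : measurable_fun setT H.
  apply/measurable_EFinP; apply: measurable_funM.
    by apply: (measurableT_comp mf); exact: measurable_funB.
  by apply: (measurableT_comp mg); exact: measurable_funB.
have iH : (mu \x mu)%E.-integrable setT H.
  apply/(@integrable12ltyP _ _ (measurableTypeR R) (measurableTypeR R) R mu mu H) => //.
  pose G := (\int[mu]_s `|g s|%:E)%E.
  have Gfin : (G < +oo)%E by move/integrableP : gi => [].
  have G0 : (0 <= G)%E by apply: integral_ge0.
  have mng : measurable_fun setT (fun s => `|g s|%:E).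
    by apply/measurable_EFinP; exact: measurableT_comp.
  have mnf : measurable_fun setT (fun s => `|f (t - s)|%:E).
    apply/measurable_EFinP; apply: measurableT_comp => //.
    by apply: (measurableT_comp mf); exact: measurable_funB.
  under eq_integral => s _.
    rewrite /H /=.
    under eq_integral do rewrite normrM EFinM.
    rewrite ge0_integralZl; first last.
    - by [].
    - by [].
    - apply/measurable_EFinP; apply: measurableT_comp => //.
      by apply: (measurableT_comp mg); exact: measurable_funB.
    - exact: measurableT.
    have -> : (\int[mu]_r `|g (s - r)|%:E = G)%E.
      rewrite /G [RHS](@ge0_integral_affine _ (-1) s); first last.
      - by [].
      - exact: mng.
      - by rewrite oppr_eq0 oner_eq0.
      by rewrite normrN1 mul1e; apply: eq_integral => r _; rewrite mulN1r addrC.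
    rewrite muleC; over.
  rewrite /= ge0_integralZl; first last.
  - by [].
  - by [].
  - exact: mnf.
  - exact: measurableT.
  apply: lte_mul_pinfty => //; first by rewrite ge0_fin_numE.
  by have /integrableP[] := integrable_subl f t fi.
pose F (z : R * R) := (f (t - z.1) * (g (z.1 - z.2) * h z.2))%:E.
have iF : (mu \x mu)%E.-integrable setT F.
  have iM : (mu \x mu)%E.-integrable setT (fun z => M%:E * H z)%E.
    exact: integrableZl.
  apply: (le_integrable measurableT _ _ iM).
    apply/measurable_EFinP; apply: measurable_funM.
      by apply: (measurableT_comp mf); exact: measurable_funB.
    apply: measurable_funM; last exact: (measurableT_comp mh).
    by apply: (measurableT_comp mg); exact: measurable_funB.
  move=> x _; rewrite -EFinM !abse_EFin lee_fin mulrA !normrM.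
  rewrite mulrC ler_wpM2r//.
  by apply: le_trans (hM _) _; exact: ler_norm.
have E1 s : (f (t - s) * conv g h s)%:E = (\int[mu]_r F (s, r))%E.
  have igh : intg (fun r => g (s - r) * h r) by exact: integrable_conv hM.
  rewrite /conv -RintegralZl// fineK//.
  apply: integrable_fin_num => //.
  exact: (integrableZl _ _ igh).
have E2 r : (conv f g (t - r) * h r)%:E = (\int[mu]_s F (s, r))%E.
  rewrite (@integral_affine _ 1 r (oner_neq0 _)); last first.
    rewrite /F /=; apply/measurable_EFinP; apply: measurable_funM.
      by apply: (measurableT_comp mf); exact: measurable_funB.
    apply: measurable_funM => //.
    by apply: (measurableT_comp mg); exact: measurable_funB.
  rewrite normr1 mul1e /F /=.
  have [hr|hr] := eqVneq (h r) 0.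
    by rewrite hr mulr0 integral0_eq// => s _; rewrite !mulr0.
  have ifg := fgi r hr.
  rewrite mulrC /conv -RintegralZl// fineK//; last first.
    by apply: integrable_fin_num => //; exact: (integrableZl _ _ ifg).
  apply: eq_integral => s _; congr EFin.
  by rewrite mul1r addrK opprD addrA addrAC; ring.
rewrite /conv /Rintegral; congr fine.
transitivity (\int[mu]_s \int[mu]_r F (s, r))%E.
  by apply: eq_integral => s _; rewrite -E1.
rewrite (@Fubini _ _ (measurableTypeR R) (measurableTypeR R) R mu mu F iF).
by apply: eq_integral => r _; rewrite -E2.
Qed.

End convolution.

(** * Riemann-Liouville kernels and their semigroup law *)

Section RL_kernel.
Context {R : realType}.
Local Notation mu := (@lebesgue_measure R).
Local Notation intg f := (mu.-integrable [set: R] (EFin \o f)).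
Implicit Types (f g h k : R -> R) (a b x t s M : R).

(** The kernel k_a cut off. Its value at 0 is always 0, also for [a = 1]. *)
Definition RLk a : R -> R := on01 (fun x => x `^ (a - 1) / Gamma a).

Lemma RLkE a x : 0 < x <= 1 -> RLk a x = x `^ (a - 1) / Gamma a.
Proof. exact: on01E. Qed.

Lemma RLk_le0 a x : x <= 0 -> RLk a x = 0.
Proof. exact: on01_le0. Qed.

Lemma RLk_ge0 a x : 0 < a -> 0 <= RLk a x.
Proof.
move=> a0; apply: (on01P _ (fun y => 0 <= y)) => // {}x _.
by rewrite divr_ge0 ?powR_ge0// ltW// Gamma_gt0.
Qed.

(** Convolution with [RLk 1] is thus plain integration, and constants count as multiples of a
    kernel. *)
Lemma RLk1 : RLk 1 = on01 (cst 1).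
Proof.
apply/funext => x; rewrite /RLk /on01 !patchE; case: ifP => // _.
by rewrite subrr powRr0 Gamma1 divr1.
Qed.

Lemma integrable_RLk a : 0 < a -> intg (RLk a).
Proof.
move=> a0; rewrite /RLk /on01 -restrict_EFin.
apply/integrable_restrict => //; rewrite setTI.
have i : mu.-integrable (`]0, 1] : set (measurableTypeR R))
    (EFin \o (fun x => x `^ (a - 1))).
  apply/integrableP; split; first by apply/measurable_EFinP; exact: measurable_powRl.
  under eq_integral do rewrite /= ger0_norm ?powR_ge0//.
  by rewrite integral_powR_itvoc// ltry.
rewrite (_ : EFin \o _ = fun x => ((Gamma a)^-1%:E *
    (EFin \o (fun x : R => (x `^ (a - 1))%R)) x)%E); first exact: integrableZl.
by apply/funext => x; rewrite /comp -EFinM mulrC.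
Qed.

Lemma measurable_RLk a : 0 < a -> measurable_fun setT (RLk a).
Proof. by move=> a0; apply: measurable_intg; exact: integrable_RLk. Qed.

Lemma RLk_le a x : 1 <= a -> RLk a x <= (Gamma a)^-1.
Proof.
move=> a1; have a0 : 0 < a by exact: lt_le_trans a1.
apply: (on01P _ (fun y => y <= (Gamma a)^-1)) => [|{}x /andP[x0 x1]].
  by rewrite invr_ge0 ltW// Gamma_gt0.
rewrite ler_piMl ?invr_ge0 ?(ltW (Gamma_gt0 _ a0))//.
have E1 : 1 `^ (a - 1) = 1 :> R by rewrite powR1.
rewrite -[leRHS]E1.
apply: ge0_ler_powR; rewrite ?nnegrE ?subr_ge0//.
exact: ltW.
Qed.

(** The extended-real form also yields integrability of the product. Just above 1 the identity
    fails: the right side is cut to 0 while the left side is still positive. This is why [x <= 1]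
    accompanies all later uses. *)
Let conv_RLkE a b x : 0 < a -> 0 < b -> 0 < x <= 1 ->
  (\int[mu]_s (RLk a (x - s) * RLk b s)%:E = (RLk (a + b) x)%:E)%E.
Proof.
move=> a0 b0 /andP[x0 x1]; rewrite RLkE ?x0//.
have ab0 := addr_gt0 a0 b0.
have Ga := Gamma_gt0 _ a0; have Gb := Gamma_gt0 _ b0; have Gab := Gamma_gt0 _ ab0.
have mxs : measurable_fun setT (fun s : R => (x - s) `^ (a - 1)).
  pose p (z : R) := z `^ (a - 1).
  have mp : measurable_fun setT p by exact: measurable_powR.
  rewrite -/(measurable_fun setT (fun s => p (x - s))).
  by apply: (measurableT_comp mp); exact: measurable_funB.
transitivity (\int[mu]_(s in `]0%R, x[) ((Gamma a * Gamma b)^-1%:E *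
   ((x - s) `^ (a - 1) * s `^ (b - 1))%:E))%E.
  rewrite [RHS]integral_mkcond; apply: eq_integral => s _; rewrite patchE.
  case: ifPn => [|/negP]; rewrite inE/= in_itv/=.
    move=> /andP[s0 sx]; rewrite !RLkE ?s0 ?(le_trans (ltW sx))//; last first.
      by rewrite subr_gt0 sx/= (le_trans _ x1)// gerBl ltW.
    rewrite -EFinM; congr EFin; move: (Gamma a) (Gamma b) Ga Gb => A B A0 B0.
    by field; rewrite !gt_eqF.
  move=> /negP; rewrite negb_and -!leNgt => /orP[s0|xs].
    by rewrite (RLk_le0 b)// mulr0.
  by rewrite RLk_le0 ?mul0r// subr_le0.
rewrite ge0_integralZl; first last.
- by rewrite lee_fin invr_ge0 (mulr_ge0 (ltW Ga) (ltW Gb)).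
- by move=> s _; rewrite lee_fin mulr_ge0 ?powR_ge0.
- apply/measurable_EFinP; apply: measurable_funM; last exact: measurable_powRl.
  by apply: measurable_funTS; exact: mxs.
- exact: measurable_itv.
rewrite integral_betaE// -EFinM; congr EFin.
move: (Gamma a) (Gamma b) (Gamma (a + b)) Ga Gb Gab => A B C A0 B0 C0.
by field; rewrite !gt_eqF.
Qed.

Lemma integrable_RLk2 a b x : 0 < a -> 0 < b -> x <= 1 ->
  intg (fun s => RLk a (x - s) * RLk b s).
Proof.
move=> a0 b0 x1; apply/integrableP; split.
  apply/measurable_EFinP; apply: measurable_funM; last exact: measurable_RLk.
  by apply: (measurableT_comp (measurable_RLk _ a0)); exact: measurable_funB.
under eq_integral do rewrite /= ger0_norm ?mulr_ge0 ?RLk_ge0//.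
have [x0|x0] := leP x 0.
  rewrite integral0_eq ?ltry// => s _.
  have [s0|s0] := leP s 0; first by rewrite (RLk_le0 b)// mulr0.
  by rewrite RLk_le0 ?mul0r//; lra.
by rewrite conv_RLkE ?x0// ltry.
Qed.

Lemma conv_RLk a b x : 0 < a -> 0 < b -> x <= 1 ->
  conv (RLk a) (RLk b) x = RLk (a + b) x.
Proof.
move=> a0 b0 x1; have [x0|x0] := leP x 0.
  rewrite conv_le0 ?RLk_le0//; exact: RLk_le0.
by rewrite /conv /Rintegral conv_RLkE// x0.
Qed.

Lemma conv_RLkA a b h M t : 0 < a -> 0 < b -> measurable_fun setT h ->
  (forall x, `|h x| <= M) -> (forall x, x <= 0 -> h x = 0) -> t <= 1 ->
  conv (RLk a) (conv (RLk b) h) t = conv (RLk (a + b)) h t.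
Proof.
move=> a0 b0 mh hM h0 t1.
(* Since [h] vanishes for nonpositive arguments, the inner convolution is only evaluated where the
   law for [RLk] holds. *)
have tr r : h r != 0 -> t - r <= 1.
  by have [/h0->|r0 _] := leP r 0; [rewrite eqxx|lra].
rewrite (convA (RLk a) (RLk b) h M)//; [|exact: integrable_RLk..|]; last first.
  by move=> r hr; apply: integrable_RLk2 => //; exact: tr.
apply: eq_Rintegral => r _; have [->|hr] := eqVneq (h r) 0; first by rewrite !mulr0.
by rewrite conv_RLk// tr.
Qed.

Lemma le_conv_RLk a h k M t : 0 < a -> measurable_fun setT h ->
  measurable_fun setT k -> (forall x, k x <= M) ->
  (forall x, `|h x| <= k x) -> `|conv (RLk a) h t| <= conv (RLk a) k t.
Proof.
move=> a0 mh mk kM hk.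
have kM' x : `|k x| <= M by rewrite ger0_norm// (le_trans _ (hk x)).
have hM x : `|h x| <= M by exact: le_trans (hk x) _.
have iK := integrable_RLk a a0.
have ih := integrable_conv (RLk a) h M t iK mh hM.
have ik := integrable_conv (RLk a) k M t iK mk kM'.
apply: le_trans (le_normr_Rintegral _ ih) _ => //.
apply: le_Rintegral => //; first exact: integrable_norm.
by move=> s _; rewrite normrM ger0_norm ?RLk_ge0// ler_wpM2l// RLk_ge0.
Qed.

End RL_kernel.

(** * Continuity of convolutions on [0, 1] *)

Section continuity.
Context {R : realType}.
Local Notation mu := (@lebesgue_measure R).
Local Notation intg f := (mu.-integrable [set: R] (EFin \o f)).
Implicit Types (f g h k phi : R -> R) (a b x t s M : R).

Definition C01 f := forall t, 0 <= t <= 1 ->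
  f x @[x --> within `[0, 1] (nbhs t)] --> f t.

Lemma C01P f : {within `[0, 1], continuous f} <-> C01 f.
Proof.
split=> [/subspace_continuousP fc t t01|fc].
  by apply: fc; rewrite /= in_itv.
by apply/subspace_continuousP => t; rewrite /= in_itv/=; exact: fc.
Qed.

Lemma eq_C01 f g : (forall x, 0 <= x <= 1 -> f x = g x) -> C01 f -> C01 g.
Proof.
move=> fg fc t t01; rewrite -fg//; apply: cvg_trans (fc t t01).
apply: near_eq_cvg; rewrite /prop_near1 /= /within /=; apply: nearW => x.
by rewrite /= in_itv/= => /fg.
Qed.

Lemma C01D f g : C01 f -> C01 g -> C01 (fun x => f x + g x).
Proof. by move=> fc gc t t01; apply: cvgD; [exact: fc|exact: gc]. Qed.

Lemma C01B f g : C01 f -> C01 g -> C01 (fun x => f x - g x).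
Proof. by move=> fc gc t t01; apply: cvgB; [exact: fc|exact: gc]. Qed.

Lemma C01_cst a : C01 (cst a).
Proof. by move=> t _; exact: cvg_cst. Qed.

Lemma C01Z a f : C01 f -> C01 (fun x => a * f x).
Proof. by move=> fc t t01; apply: cvgM; [exact: cvg_cst|exact: fc]. Qed.

(** The projection of the line onto [0, 1], written with absolute values so that its continuity is
    immediate. *)
Let clamp x := (1 + `|x| - `|x - 1|) / 2.

Let clamp01 x : 0 <= clamp x <= 1.
Proof.
rewrite /clamp; have [x0|x0] := ger0P x; have [x1|x1] := ger0P (x - 1); lra.
Qed.

Let clamp_id x : 0 <= x <= 1 -> clamp x = x.
Proof.
move=> /andP[x0 x1]; rewrite /clamp ger0_norm// ler0_norm; last by rewrite subr_le0.
by field.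
Qed.

Let clamp_le0 x : x <= 0 -> clamp x = 0.
Proof. by move=> x0; rewrite /clamp !ler0_norm//; [field|lra]. Qed.

Let continuous_clamp : continuous clamp.
Proof.
move=> x; apply: cvgMl; apply: cvgB.
  by apply: cvgD; [exact: cvg_cst|apply: cvg_norm; exact: cvg_id].
by apply: cvg_norm; apply: cvgB; [exact: cvg_id|exact: cvg_cst].
Qed.

(** The clause on [x <= 0] makes the extension vanish there when [f 0 = 0], so that it agrees with
    [on01 f] up to 1; the clause on the range carries bounds over. *)
Lemma C01_extend f : C01 f ->
  exists2 F, continuous F & (forall x, 0 <= x <= 1 -> F x = f x) /\
    (forall x, x <= 0 -> F x = f 0) /\ (forall x, exists2 y, 0 <= y <= 1 & F x = f y).
Proof.
move=> fc; exists (f \o clamp); last first.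
  split; first by move=> x x01 /=; rewrite clamp_id.
  split; first by move=> x x0 /=; rewrite clamp_le0.
  by move=> x; exists (clamp x); rewrite ?clamp01.
move=> x; apply: (@cvg_comp _ _ _ clamp f (nbhs x) (within `[0, 1] (nbhs (clamp x)))); last first.
  by apply: fc; exact: clamp01.
move=> P HP.
apply: (@filterS _ (nbhs x) _ (fun y => `[0, 1]%classic (clamp y) -> P (clamp y))).
  by move=> y; apply; rewrite /= in_itv/= clamp01.
exact: (continuous_clamp x _ HP).
Qed.

Lemma C01_bounded f : C01 f -> exists M, forall x, 0 <= x <= 1 -> `|f x| <= M.
Proof.
move=> fc; have nc : C01 (fun x => `|f x|).
  by move=> t t01; apply: cvg_norm; exact: fc.
have [c _ cM] := EVT_max ler01 ((C01P _).2 nc).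
by exists `|f c| => x x01; apply: cM; rewrite in_itv.
Qed.

Lemma measurable_C01 f : C01 f -> measurable_fun setT (on01 f).
Proof.
move=> fc; apply: measurable_on01.
apply: (@measurable_funS _ _ _ _ (`[0, 1] : set R)) => //.
  by apply: subset_itvr; rewrite bnd_simp.
by apply: subspace_continuous_measurable_fun => //; exact/C01P.
Qed.

Lemma bounded_on01 f M : 0 <= M -> (forall x, 0 <= x <= 1 -> `|f x| <= M) ->
  forall x, `|on01 f x| <= M.
Proof.
move=> M0 fM; apply: (on01P f (fun y => `|y| <= M)); rewrite ?normr0// => x.
by move=> /andP[x0 x1]; rewrite fM// ltW.
Qed.

Lemma C01_on01_bounded f : C01 f -> exists2 M, 0 <= M & forall x, `|on01 f x| <= M.
Proof.
move=> /C01_bounded[M fM].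
have M0 : 0 <= M by apply: le_trans (fM 0 _); rewrite ?lexx ?ler01.
by exists M => //; exact: bounded_on01.
Qed.

(** All regularity comes from [phi], so [g] may be a singular kernel. As [phi 0 = 0], extending
    [phi] by 0 to the left is continuous; the integrand is then continuous in t and dominated by M
    |g|. *)
Lemma continuous_conv phi g : C01 phi -> phi 0 = 0 -> intg g ->
  (forall x, x <= 0 -> g x = 0) -> C01 (conv (on01 phi) g).
Proof.
move=> phic phi0 gi g0.
have [F Fc [Fphi [F0 Frange]]] := C01_extend _ phic.
have [M phiM] := C01_bounded _ phic.
have FM x : `|F x| <= M by have [y y01 ->] := Frange x; exact: phiM.
have mF : measurable_fun setT F by exact: continuous_measurable_fun.
have mg := measurable_intg _ gi.
pose H t := \int[mu]_s (F (t - s) * g s).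
have HE t : 0 <= t <= 1 -> H t = conv (on01 phi) g t.
  move=> /andP[t0 t1]; apply: eq_Rintegral => s _.
  have [s0|s0] := leP s 0; first by rewrite g0 ?mulr0.
  congr (_ * _); have [ts|st] := leP t s.
    by rewrite on01_le0 ?F0// subr_le0.
  rewrite on01E; last by lra.
  by rewrite Fphi//; lra.
apply: eq_C01 HE _.
move=> t /andP[t0 t1]; apply: cvg_within_filter.
pose f t s := F (t - s) * g s.
(* Any open interval containing [0, 1] would do in place of []-1, 2[]. *)
have := @continuity_under_integral R _ _ mu f setT measurableT (-1) 2 _ _
  (fun s => M * `|g s|) _ _ t; apply.
- move=> x _; rewrite /f.
  have -> : (EFin \o (fun s => F (x - s) * g s)) = (EFin \o (fun s => g s * F (x - s))).
    by apply/funext => s; rewrite /comp mulrC.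
  apply: (intgM_bounded _ _ M) => //.
  by apply: (measurableT_comp mF); exact: measurable_funB.
- apply: aeW => s _ x _; rewrite /f.
  apply: cvgM; last exact: cvg_cst.
  apply: (@continuous_comp _ _ _ (fun x => x - s) F); last exact: Fc.
  by apply: cvgB; [exact: cvg_id|exact: cvg_cst].
- have -> : EFin \o (fun s => M * `|g s|) = (fun s => M%:E * (EFin \o (fun s => `|g s|%R)) s)%E.
    by apply/funext => s; rewrite /comp EFinM.
  apply: integrableZl => //; exact: integrable_norm.
- move=> x _; apply: aeW => s _; rewrite /f normrM ler_wpM2r//.
- by rewrite inE /= in_itv/=; lra.
Qed.

Lemma powR_cvg_within0 a : 0 < a -> x `^ a @[x --> within `[0, 1] (nbhs (0 : R))] --> (0 : R).
Proof.
move=> a0; apply/cvgrPdist_le => e e0.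
have d0 : 0 < e `^ a^-1 by exact: powR_gt0.
near=> x.
have x01 : 0 <= x <= 1.
  by near: x; rewrite /prop_near1 /= /within /=; apply: nearW => x; rewrite /= in_itv.
case/andP: x01 => x0 x1.
rewrite sub0r normrN ger0_norm ?powR_ge0//.
have -> : e = (e `^ a^-1) `^ a by rewrite -powRrM mulVf ?gt_eqF// powRr1// ltW.
apply: ge0_ler_powR; rewrite ?nnegrE ?powR_ge0//; first exact: ltW.
near: x; apply: (@filterS _ (nbhs (0 : R)) _ (fun x => 0 <= x -> x <= e `^ a^-1)).
  by move=> x xe /=; rewrite in_itv/= => /andP[x0 _]; exact: xe.
exact: lt_nbhsl_le.
Unshelve. all: by end_near. Qed.

Lemma continuous_RLk a : 1 < a -> C01 (RLk a).
Proof.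
move=> a1; pose f x := x `^ (a - 1) / Gamma a.
apply: (@eq_C01 f).
  move=> x /andP[x0 x1]; have [xp|xn] := ltP 0 x; first by rewrite RLkE// xp.
  rewrite RLk_le0// /f; have -> : x = 0 by lra.
  by rewrite powR0 ?mul0r// subr_eq0 gt_eqF.
move=> t /andP[t0 t1]; apply: cvgM; last exact: cvg_cst.
have [->|tn0] := eqVneq t 0.
  rewrite powR0 ?subr_eq0 ?gt_eqF//; apply: powR_cvg_within0; by rewrite subr_gt0.
apply: cvg_within_filter; apply: continuous_powR; by rewrite lt_def tn0.
Qed.

Lemma continuous_conv_RLk a g : 0 < a -> C01 g -> C01 (conv (RLk a) (on01 g)).
Proof.
(* [g - g 0] extends continuously by 0 to negative arguments; the constant [g 0]
   contributes a multiple of [RLk (a + 1)]. *)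
move=> a0 gc; pose g1 x := g x - g 0.
have g1c : C01 g1 by apply: C01B => //; exact: C01_cst.
have [M M0 g1M] := C01_on01_bounded _ g1c.
have mg1 := measurable_C01 _ g1c.
have iK := integrable_RLk a a0; have mK := measurable_RLk a a0.
apply: (@eq_C01 (fun t => conv (on01 g1) (RLk a) t + g 0 * RLk (a + 1) t)).
  move=> t /andP[t0 t1].
  rewrite (convC (on01 g1))// -(conv_RLk a 1)// -conv_Zr; last first.
    exact: integrable_RLk2.
  rewrite -conv_Dr; first last.
  - rewrite RLk1; apply: (integrable_conv _ _ `|g 0|) => //.
    + apply: measurable_funM => //; apply: measurable_C01; exact: C01_cst.
    + move=> x; rewrite normrM ler_piMr//.
      by apply: (on01P (cst 1) (fun y => `|y| <= 1)); rewrite ?normr0// => y _; rewrite normr1.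
  - exact: integrable_conv g1M.
  apply: eq_Rintegral => s _; congr (_ * _).
  rewrite RLk1 /on01 !patchE /g1; case: ifP => _; last by rewrite mulr0 addr0.
  by rewrite /= mulr1 subrK.
apply: C01D; first by apply: continuous_conv => //; [rewrite /g1 subrr|exact: RLk_le0].
by apply: C01Z; apply: continuous_RLk; rewrite ltrDr.
Qed.

End continuity.

(** * Derivatives relative to a set *)

Section relative_derivative.
Context {R : realType}.
Local Notation mu := (@lebesgue_measure R).
Implicit Types (A : set R) (f g h p : R -> R) (a b c l t s : R).

(** Existence and value in one relation; the rules of calculus then need no uniqueness of limits,
    which enters only in [has_derivative_inE]. *)
Definition has_derivative_in A f t l :=
  (f s - f t) / (s - t) @[s --> within A t^'] --> l.

Lemma near_within_dnbhs A t (P : R -> Prop) :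
  (forall s, A s -> s != t -> P s) -> \forall s \near within A t^', P s.
Proof.
move=> AP; change (nbhs t (fun s => s != t -> A s -> P s)).
by apply: (@nearW R (nbhs t) (fun s => s != t -> A s -> P s)) => s st As; exact: AP.
Qed.

Lemma near_at_right01 (P : R -> Prop) :
  (forall s, 0 < s <= 1 -> P s) -> \forall s \near (0 : R)^'+, P s.
Proof.
move=> P01; change (nbhs (0 : R) (fun s => 0 < s -> P s)).
apply: (@filterS _ (nbhs (0 : R)) _ (fun s => 0 <= s -> s <= 1)).
  by move=> s s1 s0; apply: P01; rewrite s0 s1// ltW.
exact: lt_nbhsl_le.
Qed.

Lemma cvg_within01_at_right (f : R -> R) (l : R) :
  f s @[s --> within `[0, 1] (nbhs (0 : R))] --> l -> f s @[s --> (0 : R)^'+] --> l.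
Proof.
apply: cvg_trans; apply: cvg_app => P HP.
have HP' : nbhs (0 : R) (fun s => `[0, 1]%classic s -> P s) by exact: HP.
have H2 : nbhs (0 : R) (fun s => 0 < s -> s <= 1).
  exact: (near_at_right01 (fun s => s <= 1) (fun s s01 => proj2 (andP s01))).
change (nbhs (0 : R) (fun s => 0 < s -> P s)).
apply: (@filterS _ (nbhs (0 : R)) _
  (fun s => (`[0, 1]%classic s -> P s) /\ (0 < s -> s <= 1))).
  by move=> s [Ps s1] s0; apply: Ps; rewrite /= in_itv/= s1// ltW.
exact: filterI.
Qed.

Lemma cvg_within_dnbhs (A : set R) (f : R -> R) (t l : R) :
  f s @[s --> within A (nbhs t)] --> l -> f s @[s --> within A t^'] --> l.
Proof.
apply: cvg_trans; apply: cvg_app => P HP.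
have HP' : nbhs t (fun s => A s -> P s) by exact: HP.
change (nbhs t (fun s => s != t -> A s -> P s)).
by apply: (@filterS _ (nbhs t) _ (fun s => A s -> P s)) => // s Ps _.
Qed.

Lemma eq_has_derivative_in A f g t l : A t -> (forall s, A s -> f s = g s) ->
  has_derivative_in A f t l -> has_derivative_in A g t l.
Proof.
move=> At fg; apply: cvg_trans; apply: near_eq_cvg.
by apply: near_within_dnbhs => s As _; rewrite /= !fg.
Qed.

Lemma has_derivative_in_continuous A f t l : has_derivative_in A f t l ->
  f s @[s --> within A t^'] --> f t.
Proof.
move=> fl.
have idt : s @[s --> within A t^'] --> t.
  by apply: cvg_within_filter; apply: cvg_within_filter; exact: cvg_id.
rewrite [X in _ --> X](_ : _ = l * (t - t) + f t); last by rewrite subrr mulr0 add0r.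
apply: cvg_trans (cvgD (cvgM fl (cvgB idt (cvg_cst t))) (cvg_cst (f t))).
apply: near_eq_cvg; apply: near_within_dnbhs => s _ st.
by rewrite !fctE/= divfK ?subr_eq0// subrK.
Qed.

Lemma has_derivative_in_cvg A f t l : has_derivative_in A f t l ->
  f s @[s --> within A (nbhs t)] --> f t.
Proof.
move=> /has_derivative_in_continuous fc P Pft.
change (nbhs t (fun s => A s -> P (f s))).
have : nbhs t (fun s => s != t -> A s -> P (f s)) by exact: (fc P Pft).
apply: (@filterS _ (nbhs t) _ (fun s => s != t -> A s -> P (f s))) => s Ps As; have [->|st] := eqVneq s t; first exact: nbhs_singleton.
exact: Ps.
Qed.

Lemma has_derivative_inD A f g t a b : has_derivative_in A f t a ->
  has_derivative_in A g t b ->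
  has_derivative_in A (fun s => f s + g s) t (a + b).
Proof.
move=> fa gb; apply: cvg_trans (cvgD fa gb); apply: near_eq_cvg.
by apply: near_within_dnbhs => s _ _; rewrite fctE/= -mulrDl; congr (_ / _); ring.
Qed.

Lemma has_derivative_inM A f g t a b : has_derivative_in A f t a ->
  has_derivative_in A g t b ->
  has_derivative_in A (fun s => f s * g s) t (a * g t + f t * b).
Proof.
move=> fa gb.
apply: cvg_trans (cvgD (cvgM fa (has_derivative_in_continuous _ _ _ _ gb))
  (cvgM (cvg_cst (f t)) gb)).
apply: near_eq_cvg; apply: near_within_dnbhs => s _ st.
by rewrite !fctE/=; field; rewrite subr_eq0.
Qed.

Lemma has_derivative_in_cst A a t : has_derivative_in A (cst a) t 0.
Proof.
have c : (fun=> 0) s @[s --> within A t^'] --> (0 : R) by exact: cvg_cst.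
apply: cvg_trans c; apply: near_eq_cvg.
by apply: near_within_dnbhs => s _ _; rewrite fctE/= subrr mul0r.
Qed.

Lemma has_derivative_in_id A t : has_derivative_in A id t 1.
Proof.
have c : (fun=> 1) s @[s --> within A t^'] --> (1 : R) by exact: cvg_cst.
apply: cvg_trans c; apply: near_eq_cvg.
by apply: near_within_dnbhs => s _ st /=; rewrite divff// subr_eq0.
Qed.

Lemma has_derivative_inZ A f t a c : has_derivative_in A f t a ->
  has_derivative_in A (fun s => c * f s) t (c * a).
Proof.
move=> fa; have := has_derivative_inM _ _ _ _ _ _ (has_derivative_in_cst A c t) fa.
by rewrite mul0r add0r.
Qed.

Lemma has_derivative_inB A f g t a b : has_derivative_in A f t a ->
  has_derivative_in A g t b ->
  has_derivative_in A (fun s => f s - g s) t (a - b).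
Proof.
move=> fa /(has_derivative_inZ _ _ _ _ (-1)); rewrite mulN1r => gb.
have := has_derivative_inD _ _ _ _ _ _ fa gb.
by under eq_fun do rewrite mulN1r.
Qed.

Lemma is_derive_has_derivative_in A f t l : is_derive t 1 f l ->
  has_derivative_in A f t l.
Proof.
move=> [df dl]; have : (h^-1 *: (f (h *: 1 + t) - f t)) @[h --> (0:R)^'] --> l.
  by rewrite -dl.
move=> fl; rewrite /has_derivative_in; apply: cvg_within_filter.
have c : (s - t) @[s --> t] --> (0 : R).
  by rewrite -(subrr t); apply: cvgB; [exact: cvg_id|exact: cvg_cst].
have st : (s - t) @[s --> t^'] --> (0 : R)^'.
  move=> P HP; change (nbhs t (fun s => s != t -> P (s - t))).
  apply: (@filterS _ (nbhs t) _ (fun s => s - t != 0 -> P (s - t))).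
    by move=> s Ps st; apply: Ps; rewrite subr_eq0.
  exact: (c _ HP).
have := cvg_comp _ _ st fl; apply: cvg_trans; apply: near_eq_cvg; near=> s.
by rewrite /= scaler1 subrK mulrC.
Unshelve. all: by end_near. Qed.

(** Gives access to the mean value theorem at interior points. *)
Lemma has_derivative_in_is_derive A f t l : nbhs t A ->
  has_derivative_in A f t l -> is_derive t 1 f l.
Proof.
move=> At fl.
have c : (h + t) @[h --> (0 : R)] --> t.
  by rewrite -[X in _ --> X]add0r; apply: cvgD; [exact: cvg_id|exact: cvg_cst].
have ht : (h + t) @[h --> (0 : R)^'] --> within A t^'.
  move=> P HP; change (nbhs (0 : R) (fun z : R => z != 0 -> P (z + t))).
  have {}HP : nbhs t (fun y => A y /\ (y != t -> A y -> P y)) by exact: filterI.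
  apply: (@filterS _ (nbhs (0 : R)) _ (fun z : R => A (z + t) /\ (z + t != t -> A (z + t) -> P (z + t)))).
    by move=> h [Ah Ph] h0; apply: Ph => //; rewrite -subr_eq0 addrK.
  exact: (c _ HP).
have fh : (h^-1 *: (f (h *: 1 + t) - f t)) @[h --> (0:R)^'] --> l.
  have := cvg_comp _ _ ht fl; apply: cvg_trans; apply: near_eq_cvg; near=> s.
  by rewrite /= scaler1 addrK mulrC.
apply: DeriveDef; first by apply/cvg_ex; exists l.
exact: cvg_lim fh.
Unshelve. all: by end_near. Qed.

Section unit_interval.
Variables (A : set R) (t : R).
Hypotheses (A01 : `]0, 1] `<=` A) (t01 : 0 <= t <= 1).

(** Needed for the uniqueness of relative derivatives. A point of [A] close to t is taken to the
    left of t, except at [t = 0], where it is taken to the right. *)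
Lemma proper_within_dnbhs : ProperFilter (within A t^').
Proof.
apply: Build_ProperFilter_ex => P.
rewrite /within /= => /nbhs_ballP[e /= e0 eP].
case/andP: t01 => t0 t1.
pose d := (if 0 < t then Num.min e t else Num.min e 1) / 2.
have d0 : 0 < d.
  by rewrite /d; case: ifPn => h; rewrite divr_gt0// lt_min e0 ?h ?ltr01.
have de : d < e.
  apply: (@le_lt_trans _ _ (e / 2)); last by lra.
  by rewrite ler_pM2r ?invr_gt0//; case: ifPn => _; rewrite ge_min lexx.
pose s := if 0 < t then t - d else t + d.
exists s; apply: eP.
- rewrite /ball /= /s; case: ifPn => _.
    by rewrite opprB addrC subrK gtr0_norm.
  by rewrite opprD addrA subrr add0r normrN gtr0_norm.
- by rewrite /s; case: ifPn => _; apply/eqP => st; move: d0; lra.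
- apply: A01; rewrite /= in_itv/= /s; case: ifPn => tp.
    have : d < t by rewrite /d tp ltr_pdivrMr// gt_min; apply/orP; right; lra.
    lra.
  have -> : t = 0 by apply/eqP; rewrite eq_le t0 leNgt tp.
  rewrite add0r d0/= /d (negbTE tp) ler_pdivrMr// ge_min; apply/orP; right; lra.
Qed.

Lemma has_derivative_in_unique f a b : has_derivative_in A f t a ->
  has_derivative_in A f t b -> a = b.
Proof.
have := proper_within_dnbhs => PF.
exact: cvg_unique.
Qed.

Lemma has_derivative_inE f a : has_derivative_in A f t a ->
  derivable_in A f t /\ derive_in A f t = a.
Proof.
have := proper_within_dnbhs => PF fa.
by split; [apply/cvg_ex; exists a|exact: cvg_lim].
Qed.

Lemma derivable_inE f : derivable_in A f t -> has_derivative_in A f t (derive_in A f t).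
Proof. by []. Qed.

End unit_interval.

Local Notation I := (`]0, 1]%classic : set R).

(** The mean value theorem on [[t, 1]]; the reference point is 1 because nothing is known at 0. *)
Lemma has_derivative_in_constant p : (forall t, 0 < t <= 1 -> has_derivative_in I p t 0) ->
  forall t, 0 < t <= 1 -> p t = p 1.
Proof.
move=> p0 t /andP[t0 t1].
have pc : {within `[t, 1], continuous p}.
  apply/subspace_continuousP => s; rewrite /= in_itv/= => /andP[ts s1].
  have s01 : 0 < s <= 1 by rewrite s1 (lt_le_trans t0).
  apply: cvg_trans (has_derivative_in_cvg _ _ _ _ (p0 s s01)); apply: cvg_app => P.
  change (nbhs s (fun x => I x -> P x) -> nbhs s (fun x => `[t, 1]%classic x -> P x)).
  apply: (@filterS _ (nbhs s) _ (fun x => I x -> P x)) => x IP.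
  rewrite /= in_itv/= => /andP[tx x1]; apply: IP.
  by rewrite /= in_itv/= x1 (lt_le_trans t0).
have pd x : x \in `]t, 1[ -> is_derive x 1 p ((cst 0 : R -> R) x).
  rewrite in_itv/= => /andP[tx x1].
  apply: (has_derivative_in_is_derive I); last by apply: p0; lra.
  have : x \in `]t, 1[ by rewrite in_itv/= tx.
  move=> /near_in_itvoo; apply: filterS => y; rewrite /= !in_itv/= => /andP[ty y1].
  by rewrite (lt_trans t0)// ltW.
have [c _] := MVT_segment t1 pd pc.
by rewrite mul0r => /eqP; rewrite subr_eq0 => /eqP.
Qed.

Lemma has_derivative_in_affine p q : (forall t, 0 < t <= 1 -> has_derivative_in I p t (q t)) ->
  (forall t, 0 < t <= 1 -> has_derivative_in I q t 0) ->
  forall t, 0 < t <= 1 -> p t = q 1 * t + (p 1 - q 1).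
Proof.
move=> pq q0 t t01; have q1 := has_derivative_in_constant _ q0.
have := has_derivative_in_constant (fun t => p t - q 1 * t) _ t t01.
rewrite mulr1 => <-; first by rewrite addrC subrK.
move=> s s01; have := has_derivative_inB _ _ _ _ _ _ (pq s s01)
  (has_derivative_inZ _ _ _ _ (q 1) (has_derivative_in_id I s)).
by rewrite mulr1 q1// subrr.
Qed.

(** [g] is extended continuously and integrated from -1, so that 0 and 1 become interior points for
    the fundamental theorem; restricting the two-sided derivative to [A] gives the one-sided
    ones. *)
Lemma integral_has_derivative_in A g : A `<=` `[0, 1] -> C01 g ->
  forall t, A t -> has_derivative_in A (conv (RLk 1) (on01 g)) t (g t).
Proof.
move=> A01 gc t At.
have A01' s : A s -> 0 <= s <= 1 by move=> /A01; rewrite /= in_itv.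
have t01 := A01' t At.
have [G Gc [Gg _]] := C01_extend _ gc.
have mG : measurable_fun setT G by exact: continuous_measurable_fun.
have iG : mu.-integrable `[-1, 2] (EFin \o G).
  apply: continuous_compact_integrable; first exact: segment_compact.
  exact: continuous_subspaceT.
have E s : 0 <= s <= 1 -> \int[mu]_(x in `[-1, s]) G x - \int[mu]_(x in `[-1, 0]) G x =
    conv (RLk 1) (on01 g) s.
  move=> /andP[s0 s1].
  have iGs : mu.-integrable `[-1, s] (EFin \o G).
    apply: (integrableS _ _ _ iG) => //; apply: subset_itvl; rewrite bnd_simp; lra.
  rewrite Rintegral_itvB//; last by rewrite bnd_simp; lra.
  rewrite -Rintegral_itv_bndo_bndc; last first.
    apply: (integrableS _ _ _ iGs) => //.
    by apply: subset_itv; rewrite bnd_simp//; lra.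
  rewrite Rintegral_mkcond; apply: eq_Rintegral => x _.
  rewrite RLk1 patchE; case: ifPn => [|/negP]; rewrite inE/= in_itv/=.
    move=> /andP[x0 xs]; rewrite !on01E; [by rewrite mul1r Gg//; lra|lra|lra].
  move=> /negP; rewrite negb_and -!leNgt => /orP[x0|sx].
    by rewrite (on01_le0 g)// mulr0.
  by rewrite on01_le0 ?mul0r// subr_le0.
pose F s := \int[mu]_(x in `[-1, s]) G x.
have [dF F't] : derivable F t 1 /\ F^`()%classic t = G t.
  apply: (@continuous_FTC1_closed _ _ _ _ 2) => //; [lra|lra|].
  exact: Gc.
have dFt : is_derive t 1 F (g t).
  by apply: DeriveDef => //; rewrite -derive1E F't Gg.
have := has_derivative_inB _ _ _ _ _ _ (is_derive_has_derivative_in A _ _ _ dFt)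
  (has_derivative_in_cst A (\int[mu]_(x in `[-1, 0]) G x) t).
rewrite subr0; by apply: eq_has_derivative_in => // s /A01' /E.
Qed.

End relative_derivative.

(** * Mittag-Leffler kernels *)

Section Mittag_Leffler.
Context {R : realType}.
Local Notation mu := (@lebesgue_measure R).
Local Notation intg f := (mu.-integrable [set: R] (EFin \o f)).
Implicit Types (f g h : R -> R) (a b x t s M L : R).

Lemma cvgn_norm_le (u : nat -> R) (l : R) M : u n @[n --> \oo] --> l ->
  (forall n, `|u n| <= M) -> `|l| <= M.
Proof.
move=> ul uM; have nl : `|u n| @[n --> \oo] --> `|l| by exact: cvg_norm.
rewrite -(cvg_lim _ nl)//; apply: limr_le; last exact: nearW.
by apply/cvg_ex; exists `|l|.
Qed.

Lemma dominated_conv f (g_ : nat -> R -> R) g M t : intg f ->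
  (forall n, measurable_fun setT (g_ n)) -> measurable_fun setT g ->
  (forall x, g_ n x @[n --> \oo] --> g x) -> (forall n x, `|g_ n x| <= M) ->
  conv f (g_ n) t @[n --> \oo] --> conv f g t.
Proof.
move=> fi mg_ mg gg gM.
have mf := measurable_intg _ (integrable_subl f t fi).
have gM' x : `|g x| <= M by apply: cvgn_norm_le (gg x) _ => n; exact: gM.
have iD : mu.-integrable [set: R] (fun s => M%:E * (EFin \o (fun s => `|f (t - s)|%R)) s)%E.
  apply: integrableZl => //; apply: integrable_norm; exact: integrable_subl.
have [] := @dominated_convergence _ _ _ mu setT measurableT
  (fun n s => (f (t - s) * g_ n s)%:E) (fun s => (f (t - s) * g s)%:E) _ _ _ _ iD _.
- by move=> n; apply/measurable_EFinP; apply: measurable_funM; [exact: mf|exact: mg_].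
- by apply/measurable_EFinP; apply: measurable_funM; [exact: mf|exact: mg].
- apply: aeW => s _; apply: cvg_EFin; first exact: nearW.
  by apply: cvgM; [exact: cvg_cst|exact: gg].
- apply: aeW => s n _; rewrite /comp abse_EFin -EFinM lee_fin normrM mulrC.
  by rewrite ler_wpM2r.
move=> ifg _; rewrite -[X in _ --> X]fineK; last exact: integrable_fin_num.
exact: fine_cvg.
Qed.

Lemma Gamma_series_bound a b L : 1 <= a -> 0 < b -> 0 <= L ->
  exists2 C, 0 <= C & forall k : nat, L ^+ k / Gamma (a * k%:R + b) <= C * 2^-1 ^+ k.
Proof.
move=> a1 b0 L0.
(* Since [Gamma z] dominates [A `^ (z - 1)] up to a constant, [A >= 2 L] makes the
   terms decay geometrically with ratio 1/2. *)
pose A : R := Num.max 1 (2 * L).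
have A1 : 1 <= A by rewrite le_max lexx.
have A0 : 0 < A by exact: lt_le_trans A1.
have LA : 2 * L <= A by rewrite le_max lexx orbT.
have Gb := Gamma_gt0 _ b0.
pose C := Num.max (Gamma b)^-1 (expR (A + 1) * A).
exists C; first by rewrite le_max invr_ge0 (ltW Gb).
(* The term of index 0 is separate because [Gamma_ge] needs an argument at least 1, and [b] may be
   smaller. *)
case=> [|k]; first by rewrite mulr0 add0r !expr0 mul1r mulr1 le_max lexx.
set z := a * k.+1%:R + b.
have zk : k%:R <= z - 1.
  have : k.+1%:R <= a * k.+1%:R by rewrite ler_peMl.
  by rewrite /z -natr1; lra.
have z1 : 1 <= z by move: zk; have := ler0n R k; lra.
have Gz := Gamma_ge A z A0 z1.
have AkG : A ^+ k * expR (- A - 1) <= Gamma z.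
  apply: le_trans Gz; rewrite ler_wpM2r ?expR_ge0// -powR_mulrn ?(ltW A0)//.
  exact: ler_powR.
have P0 : 0 < A ^+ k * expR (- A - 1) by rewrite mulr_gt0 ?exprn_gt0 ?expR_gt0.
apply: (@le_trans _ _ (expR (A + 1) * A * 2^-1 ^+ k.+1)); last first.
  by rewrite ler_wpM2r ?exprn_ge0// le_max lexx orbT.
apply: (@le_trans _ _ (L ^+ k.+1 / (A ^+ k * expR (- A - 1)))).
  have G0 : 0 < Gamma z := lt_le_trans P0 AkG.
  by rewrite ler_wpM2l ?exprn_ge0 // lef_pV2 ?posrE ?G0 ?P0 ?AkG.
rewrite ler_pdivrMr//.
have -> : expR (A + 1) * A * 2^-1 ^+ k.+1 * (A ^+ k * expR (- A - 1)) = (A / 2) ^+ k.+1.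
  have -> : expR (- A - 1) = (expR (A + 1))^-1 by rewrite -expRN opprD.
  rewrite exprMn (exprS A); field.
  by rewrite gt_eqF// expR_gt0.
by apply: lerXn2r; rewrite ?nnegrE ?divr_ge0 ?(ltW A0)//; lra.
Qed.

Definition ml_sum a b x n := \sum_(0 <= k < n) (x ^+ k / Gamma (a * k%:R + b)).

(** The bound is uniform in x and n, as required for dominated convergence. *)
Lemma ml_sum_bound a b L : 1 <= a -> 0 < b -> 0 <= L ->
  exists2 C, 0 <= C & forall x, `|x| <= L ->
    cvgn (ml_sum a b x) /\ (forall n, `|ml_sum a b x n| <= C).
Proof.
move=> a1 b0 L0; have [C C0 HC] := Gamma_series_bound a b L a1 b0 L0.
have G0 k : 0 < Gamma (a * k%:R + b).
  by apply: Gamma_gt0; rewrite ltr_wpDl// mulr_ge0// (le_trans _ a1).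
exists (2 * C); first by rewrite mulr_ge0.
move=> x xL.
have T k : `|x ^+ k / Gamma (a * k%:R + b)| <= C * 2^-1 ^+ k.
  rewrite normrM normrX normfV (gtr0_norm (G0 k)).
  apply: le_trans (HC k); rewrite ler_wpM2r// ?invr_ge0 ?(ltW (G0 k))//.
  by apply: lerXn2r; rewrite ?nnegrE.
have h2 : `|2^-1 : R| < 1 by rewrite ger0_norm ?invr_ge0//; lra.
have gC := @cvg_geometric_series R C 2^-1 h2.
split.
  apply: normed_cvg; apply: (@series_le_cvg _ _ (geometric C 2^-1)).
  - by move=> n; exact: normr_ge0.
  - by move=> n; rewrite /geometric/= mulr_ge0// exprn_ge0// invr_ge0.
  - exact: T.
  - by apply/cvg_ex; eexists; exact: gC.
move=> n; apply: le_trans (ler_norm_sum _ _ _) _.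
apply: (@le_trans _ _ (series (geometric C 2^-1) n)); first by apply: ler_sum.
have -> : 2 * C = C * (1 - 2^-1)^-1 by field.
rewrite -(cvg_lim _ gC)//; apply: nondecreasing_cvgn_le.
  by apply: nondecreasing_series => k _ _; rewrite /geometric/= mulr_ge0// exprn_ge0// invr_ge0.
by apply/cvg_ex; eexists; exact: gC.
Qed.

Variables (alpha lambda : R).
Hypothesis alpha1 : 1 <= alpha.

Let alpha0 : 0 < alpha. Proof. exact: lt_le_trans alpha1. Qed.

Let ak0 b (k : nat) : 0 < b -> 0 < alpha * k%:R + b.
Proof. by move=> b0; rewrite ltr_wpDl// mulr_ge0// ltW. Qed.

Definition ml_kernel b : R -> R :=
  on01 (fun x => x `^ (b - 1) * mittag_leffler alpha b (lambda * x `^ alpha)).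

(** Partial sums of e_b expressed in the kernels [RLk], so that convolution acts on each term by
    adding indices. *)
Definition ml_kernel_sum b (n : nat) x :=
  \sum_(0 <= k < n) (lambda ^+ k * RLk (alpha * k%:R + b) x).

Lemma ml_kernel_sumE b n x : 0 < x <= 1 ->
  ml_kernel_sum b n x = x `^ (b - 1) * ml_sum alpha b (lambda * x `^ alpha) n.
Proof.
move=> x01; rewrite /ml_sum mulr_sumr; apply: eq_bigr => k _; rewrite RLkE//.
case/andP: x01 => x0 x1.
have -> : x `^ (alpha * k%:R + b - 1) = x `^ (b - 1) * (x `^ alpha) ^+ k.
  rewrite -powR_mulrn ?powR_ge0// -powRrM -powRD; last by rewrite (gt_eqF x0) implybT.
  by congr (_ `^ _); ring.
by rewrite exprMn; ring.
Qed.

(** A bound relative to [RLk b] keeps the singularity x^(b-1): it gives integrability for every b >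
    0 and boundedness for b >= 1. *)
Lemma ml_kernel_bound b : 0 < b -> exists2 M, 0 <= M & forall x,
  ml_kernel_sum b n x @[n --> \oo] --> ml_kernel b x /\
  (forall n, `|ml_kernel_sum b n x| <= M * RLk b x).
Proof.
move=> b0; have [C C0 HC] := ml_sum_bound alpha b `|lambda| alpha1 b0 (normr_ge0 _).
have Gb := Gamma_gt0 _ b0.
exists (C * Gamma b); first by rewrite mulr_ge0// ltW.
have out x : ~~ (0 < x <= 1) -> (forall n, ml_kernel_sum b n x = 0) /\ ml_kernel b x = 0.
  move=> x01; have E f : on01 f x = 0.
    have [x0|x0] := leP x 0; first by rewrite on01_le0.
    by rewrite on01_gt1//; move: x01; rewrite x0/= -ltNge.
  split=> [n|]; last exact: E.
  by rewrite /ml_kernel_sum big1// => k _; rewrite /RLk E mulr0.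
move=> x; have [x01|x01] := boolP (0 < x <= 1); last first.
  have [S0 ->] := out x x01; split.
    by under eq_fun do rewrite S0; exact: cvg_cst.
  by move=> n; rewrite S0 normr0 !mulr_ge0 ?RLk_ge0// ltW.
have xL : `|lambda * x `^ alpha| <= `|lambda|.
  rewrite normrM ler_piMr// ger0_norm ?powR_ge0//.
  have E1 : 1 `^ alpha = 1 :> R by rewrite powR1.
  case/andP: x01 => x0 x1; rewrite -[leRHS]E1.
  by apply: ge0_ler_powR; rewrite ?nnegrE//; exact: ltW.
have [Sc SC] := HC _ xL; split.
  under eq_fun do rewrite ml_kernel_sumE//.
  by rewrite /ml_kernel on01E//; apply: cvgMr.
move=> n; rewrite ml_kernel_sumE// normrM ger0_norm ?powR_ge0// RLkE//.
rewrite [leRHS](_ : _ = x `^ (b - 1) * C); last by field; rewrite gt_eqF.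
by rewrite ler_wpM2l// powR_ge0.
Qed.

Lemma measurable_ml_kernel_sum b n : 0 < b -> measurable_fun setT (ml_kernel_sum b n).
Proof.
move=> b0; apply: measurable_sum => k; apply: measurable_funM => //.
by apply: measurable_RLk; exact: ak0.
Qed.

Lemma measurable_ml_kernel b : 0 < b -> measurable_fun setT (ml_kernel b).
Proof.
move=> b0; have [M _ HM] := ml_kernel_bound b b0.
apply: (@measurable_fun_cvg _ _ _ setT (ml_kernel_sum b)).
  by move=> n; exact: measurable_ml_kernel_sum.
by move=> x _; have [] := HM x.
Qed.

Lemma ml_kernel_norm_le b : 0 < b ->
  exists2 M, 0 <= M & forall x, `|ml_kernel b x| <= M * RLk b x.
Proof.
move=> b0; have [M M0 HM] := ml_kernel_bound b b0; exists M => // x.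
have [xc xM] := HM x.
exact: cvgn_norm_le xc xM.
Qed.

Lemma integrable_ml_kernel b : 0 < b -> intg (ml_kernel b).
Proof.
move=> b0; have [M M0 HM] := ml_kernel_norm_le b b0.
have iM : mu.-integrable [set: R] (fun x => M%:E * (EFin \o RLk b) x)%E.
  by apply: integrableZl => //; exact: integrable_RLk.
apply: (le_integrable measurableT _ _ iM).
  by apply/measurable_EFinP; exact: measurable_ml_kernel.
move=> x _; rewrite /comp -EFinM !abse_EFin lee_fin.
by rewrite (le_trans (HM x))// ler_norm.
Qed.

Lemma ml_kernel_bounded b : 1 <= b -> exists M, forall x, `|ml_kernel b x| <= M.
Proof.
move=> b1; have b0 : 0 < b by exact: lt_le_trans b1.
have [M M0 HM] := ml_kernel_norm_le b b0; exists (M / Gamma b) => x.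
by apply: le_trans (HM x) _; rewrite ler_wpM2l// RLk_le.
Qed.

Let conv_ml_kernel_sum b n t : 0 < b -> t <= 1 ->
  conv (RLk b) (ml_kernel_sum alpha n) t =
  \sum_(0 <= k < n) (lambda ^+ k * RLk (alpha * k.+1%:R + b) t).
Proof.
move=> b0 t1.
have iR k : intg (fun s => RLk b (t - s) * RLk (alpha * k%:R + alpha) s).
  by apply: integrable_RLk2 => //; exact: ak0.
have iS m : intg (fun s => RLk b (t - s) * ml_kernel_sum alpha m s).
  have [M M0 HM] := ml_kernel_bound alpha alpha0.
  apply: (integrable_conv _ _ (M / Gamma alpha)).
  - exact: integrable_RLk.
  - exact: measurable_ml_kernel_sum.
  - move=> x; have [_ /(_ m)/le_trans] := HM x; apply.
    by rewrite ler_wpM2l// RLk_le.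
elim: n => [|n IHn].
  rewrite big_geq// /conv; transitivity (\int[mu]_(s in [set: R]) 0).
    by apply: eq_Rintegral => s _; rewrite /ml_kernel_sum big_geq// mulr0.
  by rewrite Rintegral_cst// mul0r.
rewrite big_nat_recr//= -IHn.
transitivity (conv (RLk b) (fun s => ml_kernel_sum alpha n s +
    lambda ^+ n * RLk (alpha * n%:R + alpha) s) t).
  by apply: eq_Rintegral => s _; rewrite /ml_kernel_sum big_nat_recr.
rewrite conv_Dr; [|exact: iS|]; last first.
  have := @integrableZl _ _ _ mu setT measurableT (lambda ^+ n) _ (iR n).
  apply: eq_integrable => // s _.
  by rewrite /comp -EFinM mulrCA.
have -> : conv (RLk b) (fun s => lambda ^+ n * RLk (alpha * n%:R + alpha) s) t =
    lambda ^+ n * conv (RLk b) (RLk (alpha * n%:R + alpha)) t.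
  by apply: conv_Zr; exact: iR.
rewrite (conv_RLk _ _ _ b0 (ak0 _ n alpha0) t1).
suff -> : b + (alpha * n%:R + alpha) = alpha * n.+1%:R + b by [].
by rewrite -natr1; ring.
Qed.

(** The limit is exchanged with the convolution by dominated convergence: the possibly singular
    [RLk b] is the integrable factor, and the partial sums of e_alpha are bounded since alpha >=
    1. *)
Lemma ml_kernel_eq b t : 0 < b -> t <= 1 ->
  ml_kernel b t = RLk b t + lambda * conv (RLk b) (ml_kernel alpha) t.
Proof.
move=> b0 t1.
have [Ma Ma0 HMa] := ml_kernel_bound alpha alpha0.
have [Mb Mb0 HMb] := ml_kernel_bound b b0.
have [ct _] := HMb t.
(* The index is shifted because the term 0 is [RLk b] and the other n terms come from the
   convolution. *)
have c1 : ml_kernel_sum b n.+1 t @[n --> \oo] --> ml_kernel b t.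
  by rewrite (cvg_shiftS (fun n => ml_kernel_sum b n t)).
have c2 : (RLk b t + lambda * conv (RLk b) (ml_kernel_sum alpha n) t) @[n --> \oo] -->
    RLk b t + lambda * conv (RLk b) (ml_kernel alpha) t.
  apply: cvgD; first exact: cvg_cst.
  apply: cvgM; first exact: cvg_cst.
  apply: (dominated_conv _ _ _ (Ma / Gamma alpha)).
  - exact: integrable_RLk.
  - by move=> n; exact: measurable_ml_kernel_sum.
  - exact: measurable_ml_kernel.
  - by move=> x; have [] := HMa x.
  - move=> n x; have [_ /(_ n)/le_trans] := HMa x; apply.
    by rewrite ler_wpM2l// RLk_le.
apply: (cvg_unique _ c1) => //.
move: c2; apply: cvg_trans; apply: near_eq_cvg; apply: nearW => n.
rewrite conv_ml_kernel_sum// /ml_kernel_sum big_nat_recl//= expr0 mul1r mulr0 add0r.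
congr (_ + _); rewrite mulr_sumr; apply: eq_bigr => k _.
by rewrite exprS mulrA.
Qed.

End Mittag_Leffler.

(** * Riemann-Liouville integrals of continuous functions *)

Section RL_operator.
Context {R : realType}.
Local Notation mu := (@lebesgue_measure R).
Local Notation intg f := (mu.-integrable [set: R] (EFin \o f)).
Implicit Types (A : set R) (f g h : R -> R) (a b c d x t s M : R).

(* [RL_integral alpha] of the problem is [RLI (RL_order alpha - alpha)]: its
   argument is the order of the derivative, not of the integral. *)
Definition RLI a f : R -> R := conv (RLk a) (on01 f).

Let intJ a f t : 0 < a -> C01 f -> intg (fun s => RLk a (t - s) * on01 f s).
Proof.
move=> a0 fc; have [M _ fM] := C01_on01_bounded _ fc.
by apply: (integrable_conv _ _ M) => //; [exact: integrable_RLk|exact: measurable_C01].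
Qed.

Lemma RLI_le0 a f t : t <= 0 -> RLI a f t = 0.
Proof. by apply: conv_le0; [exact: RLk_le0|exact: on01_le0]. Qed.

Lemma continuous_RLI a f : 0 < a -> C01 f -> C01 (RLI a f).
Proof. exact: continuous_conv_RLk. Qed.

Lemma eq_RLI a f g t : (forall s, 0 < s <= 1 -> f s = g s) -> RLI a f t = RLI a g t.
Proof.
move=> fg; apply: eq_conv; first exact: RLk_le0.
move=> s _; rewrite /on01 !patchE; case: ifPn => //.
by rewrite inE/= in_itv/= => /fg.
Qed.

Lemma RLI_lin a c d f g t : 0 < a -> C01 f -> C01 g ->
  RLI a (fun s => c * f s + d * g s) t = c * RLI a f t + d * RLI a g t.
Proof.
move=> a0 fc gc; rewrite /RLI.
transitivity (conv (RLk a) (fun s => c * on01 f s + d * on01 g s) t).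
  apply: eq_Rintegral => s _; congr (_ * _); rewrite /on01 !patchE.
  by case: ifP => // _; rewrite !mulr0 addr0.
have iZ k h : C01 h -> intg (fun s => RLk a (t - s) * (k * on01 h s)).
  move=> hc; have := @integrableZl _ _ _ mu setT measurableT k _ (intJ a h t a0 hc).
  by apply: eq_integrable => // s _; rewrite /comp -EFinM mulrCA.
rewrite conv_Dr; [|exact: iZ|exact: iZ].
by congr (_ + _); apply: conv_Zr; exact: intJ.
Qed.

Lemma RLI_RLI a b f t : 0 < a -> 0 < b -> C01 f -> t <= 1 ->
  RLI a (RLI b f) t = RLI (a + b) f t.
Proof.
move=> a0 b0 fc t1; have [M _ fM] := C01_on01_bounded _ fc.
rewrite {1}/RLI conv_on01; [|exact: RLk_le0|by move=> x; exact: RLI_le0|exact: t1].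
apply: (conv_RLkA _ _ _ M) => //; first exact: measurable_C01.
exact: on01_le0.
Qed.

Lemma RLI_RLk a b t : 0 < a -> 0 < b -> t <= 1 -> RLI a (RLk b) t = RLk (a + b) t.
Proof.
move=> a0 b0 t1; rewrite /RLI conv_on01//; [exact: conv_RLk|exact: RLk_le0..].
Qed.

(** [f] is compared with the constant M, that is M times [RLk 1], whose fractional integral is
    explicit. The rate t^a will absorb the negative powers of t in the weighted C^1 condition. *)
Lemma RLI_bound a f : 0 < a -> C01 f -> exists2 M, 0 <= M &
  forall t, 0 <= t <= 1 -> `|RLI a f t| <= M * t `^ a.
Proof.
move=> a0 fc; have [M M0 fM] := C01_on01_bounded _ fc.
have a10 : 0 < a + 1 by rewrite addr_gt0.
exists (M / Gamma (a + 1)); first by rewrite divr_ge0// ltW// Gamma_gt0.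
move=> t /andP[t0 t1]; have [tp|tn] := ltP 0 t; last first.
  by rewrite RLI_le0// normr0 mulr_ge0 ?powR_ge0// divr_ge0// ltW// Gamma_gt0.
apply: (@le_trans _ _ (conv (RLk a) (fun s => M * RLk 1 s) t)).
  apply: (le_conv_RLk _ _ _ M) => //.
  - exact: measurable_C01.
  - by apply: measurable_funM => //; exact: measurable_RLk.
  - by move=> x; rewrite ler_piMr//; have := RLk_le 1 x (lexx _); rewrite Gamma1 invr1.
  - move=> x; rewrite RLk1 /on01 patchE; case: ifPn => x01.
      by have := fM x; rewrite /on01 !patchE x01 mulr1.
    by rewrite patchE (negbTE x01) normr0 mulr0.
rewrite conv_Zr; last exact: integrable_RLk2.
rewrite conv_RLk// RLkE ?tp// addrK.
by rewrite mulrA mulrAC.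
Qed.

Lemma RLI1_has_derivative A f t : A `<=` `[0, 1] -> C01 f -> A t ->
  has_derivative_in A (RLI 1 f) t (f t).
Proof. by move=> A01 fc; exact: integral_has_derivative_in. Qed.

(** By the semigroup law this is the plain integral of the continuous function [RLI a f]. *)
Lemma RLI_has_derivative A a f t : A `<=` `[0, 1] -> 0 < a -> C01 f -> A t ->
  has_derivative_in A (RLI (1 + a) f) t (RLI a f t).
Proof.
move=> A01 a0 fc At.
have := RLI1_has_derivative A (RLI a f) t A01 (continuous_RLI _ _ a0 fc) At.
apply: eq_has_derivative_in => // s /A01; rewrite /= in_itv/= => /andP[_ s1].
exact: RLI_RLI.
Qed.

Lemma RLk_has_derivative A a t : A `<=` `[0, 1] -> 0 < a -> A t -> 0 < t ->
  has_derivative_in A (RLk (1 + a)) t (RLk a t).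
Proof.
move=> A01 a0 At t0; have Ga := Gamma_gt0 _ a0.
have t1 : t <= 1 by move/A01 : At; rewrite /= in_itv/= => /andP[].
have D : has_derivative_in A (fun s => (Gamma (1 + a))^-1 * s `^ a) t (RLk a t).
  rewrite RLkE ?t0//.
  have -> : t `^ (a - 1) / Gamma a = (Gamma (1 + a))^-1 * (a * t `^ (a - 1)).
    rewrite GammaS//; move: (Gamma a) Ga => G G0.
    by field; rewrite !gt_eqF.
  apply: has_derivative_inZ; apply: is_derive_has_derivative_in.
  exact: is_derive_powR.
apply: eq_has_derivative_in D => // s /A01; rewrite /= in_itv/= => /andP[s0 s1].
have [sp|sn] := ltP 0 s.
  by rewrite RLkE ?sp// addrAC subrr add0r mulrC.
rewrite RLk_le0//; have -> : s = 0 by lra.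
by rewrite powR0 ?gt_eqF// mulr0.
Qed.

Lemma Gamma2 : Gamma (2 : R) = 1.
Proof. by rewrite (_ : 2 = 1 + 1 :> R) ?GammaS ?Gamma1 ?mulr1. Qed.

Lemma RLk2 t : 0 <= t <= 1 -> RLk 2 t = t.
Proof.
move=> /andP[t0 t1]; have [tp|tn] := ltP 0 t; last by rewrite RLk_le0//; lra.
by rewrite RLkE ?tp// Gamma2 divr1 (_ : 2 - 1 = 1) ?powRr1//; lra.
Qed.

(** The integrands may differ at [s = 0], where [u] is arbitrary, and at [s = t], where the value of
    the power is a convention; so only the open interval is compared. *)
Lemma integral_RLI a f u t : 0 < a -> C01 f -> 0 < t <= 1 ->
  (forall s, 0 < s <= 1 -> u s = f s) ->
  (Gamma a)^-1 * \int[mu]_(s in `[0, t]) ((t - s) `^ (a - 1) * u s) = RLI a f t.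
Proof.
move=> a0 fc /andP[t0 t1] uf; have Ga := Gamma_gt0 _ a0.
have i : intg (fun s => RLk a (t - s) * on01 f s) by exact: intJ.
have mi : measurable_fun setT (fun s => RLk a (t - s) * on01 f s) by exact: measurable_intg.
have E s : `]0, t[%classic s -> (t - s) `^ (a - 1) * u s =
    Gamma a * (RLk a (t - s) * on01 f s).
  rewrite /= in_itv/= => /andP[s0 st]; rewrite RLkE; last by lra.
  rewrite on01E; last by lra.
  rewrite uf; last by lra.
  move: (Gamma a) Ga => G G0; field; by rewrite gt_eqF.
have mu' : measurable_fun (`]0, t[ : set R) (fun s => (t - s) `^ (a - 1) * u s).
  apply: (eq_measurable_fun (fun s => Gamma a * (RLk a (t - s) * on01 f s))).
    by move=> s /set_mem/E.
  by apply: measurable_funM => //; exact: measurable_funTS.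
have -> : \int[mu]_(s in `[0, t]) ((t - s) `^ (a - 1) * u s) =
    \int[mu]_(s in `[0, t]) (Gamma a * (RLk a (t - s) * on01 f s)).
  rewrite /Rintegral; congr fine; apply: eq_integral_itv_bounded => //.
    by apply: measurable_funM => //; exact: measurable_funTS.
rewrite RintegralZl//; last exact: integrableS i.
rewrite mulrA mulVf ?gt_eqF// mul1r Rintegral_mkcond; apply: eq_Rintegral => s _.
rewrite patchE; case: ifPn => // /negP; rewrite inE/= in_itv/= => /negP.
rewrite negb_and -!ltNge => /orP[s0|ts]; first by rewrite on01_le0 ?mulr0// ltW.
by rewrite RLk_le0 ?mul0r//; lra.
Qed.

End RL_operator.

Lemma on01_on01 {R : realType} (f : R -> R) : on01 (on01 f) = on01 f.
Proof.
apply/funext => x; rewrite /on01 patchE; case: ifPn => // xI.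
by rewrite patchE (negbTE xI).
Qed.

Lemma integrable_C01 {R : realType} (f : R -> R) : C01 f ->
  lebesgue_measure.-integrable [set: R] (EFin \o on01 f).
Proof.
move=> fc; have [M fM] := C01_bounded _ fc.
apply: (intg_on01_bounded _ M).
  by apply: (measurable_restrictT f (measurable_itv _)).2; exact: measurable_C01.
by move=> x /andP[x0 x1]; apply: fM; rewrite ltW.
Qed.

(** * The Volterra equation *)

Section integral_equation.
Context {R : realType}.
Local Notation mu := (@lebesgue_measure R).
Local Notation intg f := (mu.-integrable [set: R] (EFin \o f)).
Local Notation I := (`]0, 1]%classic : set R).
Implicit Types (A : set R) (f g h u v w : R -> R) (b c d x t s M : R).

Variables (alpha lambda : R) (y : R -> R).
Hypotheses (alpha_gt1 : 1 < alpha) (alpha_le2 : alpha <= 2) (yc : C01 y).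

Let alpha0 : 0 < alpha. Proof. exact: lt_trans alpha_gt1. Qed.
Let alpha1 : 1 <= alpha. Proof. exact: ltW. Qed.
Let am1 : 0 < alpha - 1. Proof. by rewrite subr_gt0. Qed.

Local Notation E := (ml_kernel alpha lambda).

Let Kc : C01 (RLk alpha). Proof. exact: continuous_RLk. Qed.

Let RLk_on01 b : on01 (RLk b) = RLk b. Proof. exact: on01_on01. Qed.

Let E_le0 b x : x <= 0 -> E b x = 0. Proof. exact: on01_le0. Qed.

Let on01_E b : on01 (E b) = E b. Proof. exact: on01_on01. Qed.

Lemma ml_kernel_RLI b t : 0 < b -> t <= 1 ->
  E b t = RLk b t + lambda * RLI b (E alpha) t.
Proof. by move=> b0 t1; rewrite /RLI on01_E; exact: ml_kernel_eq. Qed.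

(** Read off from the Volterra equation of e_alpha instead of the series: k_alpha is continuous and
    vanishes at 0 as alpha > 1, and e_alpha is integrable. *)
Lemma continuous_ml_kernel : C01 (E alpha).
Proof.
apply: (@eq_C01 _ (fun t => RLk alpha t + lambda * conv (on01 (RLk alpha)) (E alpha) t)).
  by move=> t /andP[_ t1]; rewrite RLk_on01 -ml_kernel_eq.
apply: C01D => //; apply: C01Z; apply: continuous_conv => //.
- exact: RLk_le0.
- exact: integrable_ml_kernel.
- exact: E_le0.
Qed.

Let Ec := continuous_ml_kernel.

Definition ml_conv b : R -> R := conv (E b) (on01 y).

Lemma continuous_ml_conv : C01 (ml_conv alpha).
Proof.
rewrite /ml_conv -on01_E; apply: continuous_conv => //; first exact: E_le0.
  exact: integrable_C01.
exact: on01_le0.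
Qed.

Let qc := continuous_ml_conv.

(** The equation of e_b convolved with y; associativity moves y inside the fractional integral. *)
Lemma ml_conv_RLI b t : 0 < b -> t <= 1 ->
  ml_conv b t = RLI b y t + lambda * RLI b (ml_conv alpha) t.
Proof.
move=> b0 t1; have [M M0 yM] := C01_on01_bounded _ yc.
have my := measurable_C01 _ yc.
have [Me EM] := ml_kernel_bounded alpha lambda alpha1 alpha alpha1.
have mE := measurable_ml_kernel alpha lambda alpha1 alpha alpha0.
have iE := integrable_ml_kernel alpha lambda alpha1 alpha alpha0.
have iK := integrable_RLk b b0.
(* Cut off to be integrable on the line; only arguments at most 1 enter the convolution. *)
pose F := on01 (RLI b (E alpha)).
have RLIE x : x <= 1 -> RLI b (E alpha) x = F x.
  by move=> x1; rewrite /F on01_id// => z; exact: RLI_le0.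
have Fc : C01 (RLI b (E alpha)) by exact: continuous_RLI.
have iF : intg F by exact: integrable_C01.
have iKy : intg (fun s => RLk b (t - s) * on01 y s) by exact: integrable_conv yM.
have iFy : intg (fun s => F (t - s) * on01 y s) by exact: integrable_conv yM.
transitivity (conv (fun s => RLk b s + lambda * F s) (on01 y) t).
  apply: eq_convl; first exact: on01_le0.
  move=> s st; have s1 : s <= 1 by lra.
  by rewrite ml_kernel_RLI// RLIE.
have iZ : intg (fun s => lambda * F (t - s) * on01 y s).
  have := @integrableZl _ _ _ mu setT measurableT lambda _ iFy.
  by apply: eq_integrable => // s _; rewrite /comp -EFinM mulrA.
rewrite conv_Dl; [|exact: iKy|exact: iZ]; congr (_ + _).
rewrite conv_Zl; last exact: iFy.
congr (_ * _); transitivity (conv (conv (RLk b) (E alpha)) (on01 y) t).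
  apply: eq_convl; first exact: on01_le0.
  by move=> s st; rewrite -RLIE /RLI ?on01_E//; lra.
rewrite -(convA _ _ _ M)//; last by move=> r _; exact: integrable_conv EM.
rewrite /RLI conv_on01//; first exact: RLk_le0.
by move=> x; apply: conv_le0; [exact: E_le0|exact: on01_le0].
Qed.

(** The parameter [c] stands for the limit at 0 of the derivative of order alpha - 1, which the
    condition at 0 leaves free. *)
Definition integral_solution c (V : R -> R) := C01 V /\
  forall t, 0 <= t <= 1 ->
    V t = c * RLk alpha t + RLI alpha (fun s => lambda * V s - y s) t.

Let inI t : 0 < t <= 1 -> I t. Proof. by move=> t01; rewrite /= in_itv. Qed.

Let I01 : I `<=` `[0, 1].
Proof. by move=> t; rewrite /= !in_itv/= => /andP[/ltW -> ->]. Qed.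

Let proper_hd t f d : 0 < t <= 1 -> has_derivative_in I f t d ->
  derivable_in I f t /\ derive_in I f t = d.
Proof.
by move=> /andP[t0 t1]; apply: has_derivative_inE => //; rewrite ltW.
Qed.

(** The iterates agree with the candidates [F k] on [I] only; this is enough, since the derivative
    relative to [I] at a point of [I] sees no other values. *)
Lemma iter_derive_in (F : nat -> R -> R) n h :
  (forall t, 0 < t <= 1 -> h t = F 0 t) ->
  (forall k t, (k < n)%N -> 0 < t <= 1 -> has_derivative_in I (F k) t (F k.+1 t)) ->
  (forall k t, (k <= n)%N -> 0 < t <= 1 -> iter k (derive_in I) h t = F k t) /\
  (forall k t, (k < n)%N -> 0 < t <= 1 -> derivable_in I (iter k (derive_in I) h) t).
Proof.
move=> h0 FS.
have hd k : (k < n)%N -> (forall t, 0 < t <= 1 -> iter k (derive_in I) h t = F k t) ->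
    forall t, 0 < t <= 1 -> has_derivative_in I (iter k (derive_in I) h) t (F k.+1 t).
  move=> kn IH t t01; apply: eq_has_derivative_in (FS k t kn t01); first exact: inI.
  by move=> s; rewrite /= in_itv/= => s01; rewrite IH.
have iE : forall k, (k <= n)%N -> forall t, 0 < t <= 1 -> iter k (derive_in I) h t = F k t.
  elim=> [_|k IH kn] //= t t01.
  by have [] := proper_hd _ _ _ t01 (hd k kn (IH (ltnW kn)) t t01).
split=> [k t kn t01|k t kn t01]; first exact: iE.
by have [] := proper_hd _ _ _ t01 (hd k kn (iE k (ltnW kn)) t t01).
Qed.

Lemma RL_order_lt2 : alpha < 2 -> RL_order alpha = 2%N.
Proof.
move=> a2; rewrite /RL_order; congr S; apply/eqP; rewrite truncn_eq; last exact: ltW.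
by rewrite alpha1/=.
Qed.

Lemma RL_order_2 : alpha = 2 -> RL_order alpha = 3%N.
Proof. by move=> ->; rewrite /RL_order Num.Theory.natrK. Qed.

(** * From the integral equation to the boundary value problem *)

Section solution_of_integral_equation.
Variables (c : R) (V u : R -> R).
Hypotheses (Vsol : integral_solution c V) (uV : forall t, 0 < t <= 1 -> u t = V t).

Let g s := lambda * V s - y s.

Let Vc : C01 V. Proof. by have [] := Vsol. Qed.

Let gc : C01 g. Proof. by apply: C01B => //; exact: C01Z. Qed.

Let VE t : 0 <= t <= 1 -> V t = c * RLk alpha t + RLI alpha g t.
Proof. by have [_] := Vsol; exact. Qed.

Let V_RLI b t : 0 < b -> t <= 1 -> RLI b V t = c * RLk (b + alpha) t + RLI (b + alpha) g t.
Proof.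
move=> b0 t1.
transitivity (RLI b (fun s => c * RLk alpha s + 1 * RLI alpha g s) t).
  by apply: eq_RLI => s /andP[s0 s1]; rewrite mul1r VE// ltW.
rewrite RLI_lin//; last exact: continuous_RLI.
by rewrite mul1r RLI_RLk// RLI_RLI.
Qed.

(** The integral equation turns [RLI (2 - alpha) V] into [P] when alpha < 2, and [V] itself into [P]
    when alpha = 2; [P1] is the derivative. *)
Let P t := c * t + RLI 2 g t.
Let P1 t := c + RLI 1 g t.

Let hdP t : 0 < t <= 1 -> has_derivative_in I P t (P1 t).
Proof.
move=> t01; rewrite /P1 -[X in X + _]mulr1; apply: has_derivative_inD.
  by apply: has_derivative_inZ; exact: has_derivative_in_id.
rewrite (mulr2n 1); apply: RLI_has_derivative => //; exact: inI.
Qed.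

Let hdP1 t : 0 < t <= 1 -> has_derivative_in I P1 t (g t).
Proof.
move=> t01; rewrite -[X in has_derivative_in _ _ _ X]add0r; apply: has_derivative_inD.
  exact: has_derivative_in_cst.
by apply: RLI1_has_derivative => //; exact: inI.
Qed.

Lemma integral_solution_RL : RL_derivable I alpha u /\
  (forall t, 0 < t <= 1 -> RL_derive I alpha u t = lambda * u t - y t).
Proof.
have [a2|a2] := ltrP alpha 2.
  pose F (k : nat) := if k is 0 then P else if k is 1 then P1 else g.
  have h0 t : 0 < t <= 1 -> RL_integral alpha u t = F 0%N t.
    move=> t01; have [t0 t1] := andP t01.
    have b0 : 0 < (RL_order alpha)%:R - alpha by rewrite RL_order_lt2// subr_gt0.
    have t01' : 0 <= t <= 1 by rewrite t1 ltW.
    rewrite /RL_integral (integral_RLI _ V u t b0 Vc t01 uV).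
    by rewrite (V_RLI _ _ b0 t1) subrK (RL_order_lt2 a2) (RLk2 _ t01').
  have FS k t : (k < 2)%N -> 0 < t <= 1 -> has_derivative_in I (F k) t (F k.+1 t).
    by case: k => [_|[_|//]] t01; [exact: hdP|exact: hdP1].
  have [iE iD] := iter_derive_in F 2 _ h0 FS.
  split=> [k t|t t01]; rewrite ?/RL_derive RL_order_lt2//.
    by move=> k2; rewrite /= in_itv/= => t01; exact: iD.
  by rewrite iE// /F/= uV.
(* The fractional integral is now [RLI 1 V], and the chain of three derivatives first returns to
   [V]. *)
have {}a2 : alpha = 2 by apply/eqP; rewrite eq_le alpha_le2.
pose F (k : nat) := if k is 0 then RLI 1 V else if k is 1 then V else
  if k is 2 then P1 else g.
have h0 t : 0 < t <= 1 -> RL_integral alpha u t = F 0%N t.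
  move=> t01; have b1 : (RL_order alpha)%:R - alpha = 1 by rewrite RL_order_2// a2; lra.
  by rewrite /RL_integral b1 (integral_RLI _ V u t ltr01 Vc t01 uV).
have VP t : 0 <= t <= 1 -> V t = P t.
  move=> t01; by rewrite (VE _ t01) a2 (RLk2 _ t01).
have FS k t : (k < 3)%N -> 0 < t <= 1 -> has_derivative_in I (F k) t (F k.+1 t).
  case: k => [_|[_|[_|//]]] t01; last exact: hdP1.
    by apply: RLI1_has_derivative => //; exact: inI.
  apply: eq_has_derivative_in (hdP t t01); first exact: inI.
  by move=> s /I01; rewrite /= in_itv/= => s01; rewrite VP.
have [iE iD] := iter_derive_in F 3 _ h0 FS.
split=> [k t|t t01]; rewrite ?/RL_derive RL_order_2//.
  by move=> k2; rewrite /= in_itv/= => t01; exact: iD.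
by rewrite iE// /F/= uV.
Qed.

Lemma integral_solution_derive1 : has_derivative_in I u 1
  (c * RLk (alpha - 1) 1 + RLI (alpha - 1) g 1).
Proof.
have o1 : 0 < (1 : R) <= 1 by rewrite ltr01 lexx.
have aE : alpha = 1 + (alpha - 1) by rewrite addrC subrK.
apply: (@eq_has_derivative_in _ _ (fun t => c * RLk (1 + (alpha - 1)) t + RLI (1 + (alpha - 1)) g t)).
- exact: inI.
- move=> s; rewrite /= in_itv/= => s01; rewrite uV// VE; first by rewrite -aE.
  by case/andP: s01 => /ltW -> ->.
apply: has_derivative_inD.
  by apply: has_derivative_inZ; apply: RLk_has_derivative => //; exact: inI.
by apply: RLI_has_derivative => //; exact: inI.
Qed.

(** [q], with factor 2 - alpha, and [q1] are the terms of the product rule for t^(2-alpha) times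
    [RLI alpha g]. By [RLI_bound] both are O(t), which gives their continuity at 0. *)
Let q t := t `^ (1 - alpha) * RLI alpha g t.
Let q1 t := t `^ (2 - alpha) * RLI (alpha - 1) g t.

Let cvg0_le f M : (forall s, 0 <= s <= 1 -> `|f s| <= M * s) ->
  f s @[s --> within `[0, 1] (nbhs (0 : R))] --> (0 : R).
Proof.
move=> fM; apply: norm_cvg0.
have Ms : (M * s) @[s --> within `[0, 1] (nbhs (0 : R))] --> (0 : R).
  rewrite [X in _ --> X](_ : _ = M * 0); last by rewrite mulr0.
  apply: cvgM; first exact: cvg_cst.
  by apply: cvg_within_filter; exact: cvg_id.
apply: (@squeeze_cvgr _ _ _ _ (cst 0) (fun s => M * s)); [|exact: cvg_cst|exact: Ms].
apply: (@nearW R (nbhs (0 : R)) (fun s => `[0, 1]%classic s -> 0 <= `|f s| <= M * s)).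
by move=> s; rewrite /= in_itv/= => s01; rewrite normr_ge0 fM.
Qed.

Let powRM_le b d M x : 0 <= x -> b + d = 1 -> `|x `^ b * (M * x `^ d)| <= `|M| * x.
Proof.
move=> x0 bd; rewrite mulrCA normrM ler_wpM2l//.
rewrite -powRD ?bd ?oner_eq0// powRr1// ger0_norm//.
Qed.

Let q_le : exists M, forall s, 0 <= s <= 1 -> `|q s| <= M * s.
Proof.
have [M M0 gM] := RLI_bound _ _ alpha0 gc; exists `|M| => s s01.
have [s0 s1] := andP s01.
apply: le_trans (powRM_le (1 - alpha) alpha M s s0 _); last by rewrite subrK.
rewrite /q !normrM ler_wpM2l// -normrM.
by apply: le_trans (gM s s01) _; exact: ler_norm.
Qed.

Let q1_le : exists M, forall s, 0 <= s <= 1 -> `|q1 s| <= M * s.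
Proof.
have [M M0 gM] := RLI_bound _ _ am1 gc; exists `|M| => s s01.
have [s0 s1] := andP s01.
apply: le_trans (powRM_le (2 - alpha) (alpha - 1) M s s0 _); last by ring.
rewrite /q1 !normrM ler_wpM2l// -normrM.
by apply: le_trans (gM s s01) _; exact: ler_norm.
Qed.

Let q0 : q 0 = 0.
Proof. by rewrite /q RLI_le0// mulr0. Qed.

Let q10 : q1 0 = 0.
Proof. by rewrite /q1 RLI_le0// mulr0. Qed.

Let powR_C b f : C01 f -> f 0 = 0 ->
  (exists M, forall s, 0 <= s <= 1 -> `|s `^ b * f s| <= M * s) ->
  C01 (fun s => s `^ b * f s).
Proof.
move=> fc f0 [M fM] t t01; have [t0 t1] := andP t01.
have [->|tn0] := eqVneq t 0; first by rewrite f0 mulr0; exact: cvg0_le fM.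
apply: cvgM; last exact: fc.
by apply: cvg_within_filter; apply: continuous_powR; rewrite lt_def tn0.
Qed.

Let qc1 : C01 q.
Proof.
apply: powR_C; [exact: continuous_RLI|exact: RLI_le0|exact: q_le].
Qed.

Let q1c : C01 q1.
Proof.
apply: powR_C; [exact: continuous_RLI|exact: RLI_le0|exact: q1_le].
Qed.

(** The C^1 extension of t^(2-alpha) u: the weight turns c k_alpha into a linear term. *)
Let w t := c / Gamma alpha * t + t `^ (2 - alpha) * RLI alpha g t.
Let w1 t := c / Gamma alpha + ((2 - alpha) * q t + q1 t).

Let hdw t : 0 <= t <= 1 -> has_derivative_in `[0, 1] w t (w1 t).
Proof.
move=> t01; have [t0 t1] := andP t01.
have At : `[0, 1]%classic t by rewrite /= in_itv.
rewrite /w1 -[X in X + _]mulr1; apply: has_derivative_inD.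
  by apply: has_derivative_inZ; exact: has_derivative_in_id.
(* At 0 the weight need not be differentiable, but the difference quotient of the second term is
   exactly [q]. *)
have [->|tn0] := eqVneq t 0.
  rewrite q0 q10 mulr0 addr0.
  have qq : q s @[s --> within `[0, 1] (0 : R)^'] --> (0 : R).
    by apply: cvg_within_dnbhs; have [M] := q_le; exact: cvg0_le.
  apply: cvg_trans qq; apply: near_eq_cvg; apply: near_within_dnbhs => s.
  rewrite /= in_itv/= => /andP[s0 _] sn0.
  rewrite (RLI_le0 _ _ 0)// mulr0 !subr0 /q mulrAC; congr (_ * _).
  have -> : s `^ (2 - alpha) = s `^ (1 - alpha) * s.
    rewrite -{3}(powRr1 s0) -powRD ?sn0 ?implybT//; congr (_ `^ _); ring.
  by rewrite mulfK.
have tp : 0 < t by rewrite lt_def tn0.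
have aE : alpha = 1 + (alpha - 1) by rewrite addrC subrK.
have hq : has_derivative_in `[0, 1] (RLI alpha g) t (RLI (alpha - 1) g t).
  by rewrite {1}aE; apply: RLI_has_derivative.
have hp := is_derive_has_derivative_in `[0, 1] _ _ _ (is_derive_powR (2 - alpha) t tp).
have := has_derivative_inM _ _ _ _ _ _ hp hq.
have -> : 2 - alpha - 1 = 1 - alpha by ring.
by rewrite -mulrA.
Qed.

Let wu t : 0 < t <= 1 -> w t = t `^ (2 - alpha) * u t.
Proof.
move=> t01; have [t0 t1] := andP t01.
rewrite uV// VE ?t1 ?(ltW t0)// RLkE// /w mulrDr; congr (_ + _).
have tE : t = t `^ (2 - alpha) * t `^ (alpha - 1).
  rewrite -powRD ?(gt_eqF t0) ?implybT// (_ : _ + _ = 1) ?powRr1 ?(ltW t0)//; ring.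
by rewrite [X in _ * X = _]tE; ring.
Qed.

Lemma integral_solution_C1 : C1_weighted (2 - alpha) u.
Proof.
exists w; split; last by move=> t; rewrite in_itv/=; exact: wu.
have D t : 0 <= t <= 1 -> derivable_in `[0, 1] w t /\ derive_in `[0, 1] w t = w1 t.
  by move=> t01; apply: has_derivative_inE => //; exact: hdw.
split; first by move=> t; rewrite /= in_itv/= => /D[].
apply/C01P; apply: (@eq_C01 _ w1); first by move=> t /D[].
by apply: C01D; [exact: C01_cst|apply: C01D => //; exact: C01Z].
Qed.

Lemma integral_solution_lim0 : t `^ (2 - alpha) * u t @[t --> 0^'+] --> 0.
Proof.
have w0 : w 0 = 0 by rewrite /w RLI_le0// !mulr0 addr0.
have o01 : 0 <= (0 : R) <= 1 by rewrite lexx ler01.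
have := cvg_within01_at_right _ _ (has_derivative_in_cvg _ _ _ _ (hdw 0 o01)).
rewrite w0; apply: cvg_trans; apply: near_eq_cvg.
by apply: near_at_right01 => s s01; rewrite /= wu.
Qed.

End solution_of_integral_equation.

Lemma RLI_eigenfunction0 Z : C01 Z ->
  (forall t, 0 <= t <= 1 -> Z t = lambda * RLI alpha Z t) ->
  forall t, 0 <= t <= 1 -> Z t = 0.
Proof.
move=> Zc ZE; have [M M0 ZM] := C01_on01_bounded _ Zc.
have ak (n : nat) : 1 <= alpha * n%:R + 1 by rewrite lerDr mulr_ge0// ltW.
have ak0 (n : nat) : 0 < alpha * n%:R + 1 by exact: lt_le_trans (ak n).
have bound (n : nat) x : `|on01 Z x| <= M * `|lambda| ^+ n * RLk (alpha * n%:R + 1) x.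
  elim: n x => [|n IHn] x.
    rewrite mulr0 add0r expr0 mulr1 RLk1 /on01 patchE; case: ifPn => xI.
      by have := ZM x; rewrite /on01 !patchE xI mulr1.
    by rewrite patchE (negbTE xI) normr0 mulr0.
  have [/andP[x0 x1]|xI] := boolP (0 < x <= 1); last first.
    have O f : on01 f x = 0.
      have [x0|x0] := leP x 0; first by rewrite on01_le0.
      by rewrite on01_gt1//; move: xI; rewrite x0/= -ltNge.
    by rewrite O /RLk O normr0 mulr0.
  rewrite on01E ?x0// ZE ?x1 ?(ltW x0)// normrM.
  have := le_conv_RLk alpha (on01 Z) (fun s => M * `|lambda| ^+ n * RLk (alpha * n%:R + 1) s)
    (M * `|lambda| ^+ n * (Gamma (alpha * n%:R + 1))^-1) x alpha0.
  move=> /(_ (measurable_C01 _ Zc) _ _ IHn).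
  rewrite conv_Zr; last exact: integrable_RLk2.
  rewrite (conv_RLk _ _ _ alpha0 (ak0 n) x1).
  have -> : alpha + (alpha * n%:R + 1) = alpha * n.+1%:R + 1 by rewrite -natr1; ring.
  move=> H; have {}H := H _ _.
  rewrite exprS mulrCA -!mulrA ler_wpM2l// mulrA; apply: H.
  - by apply: measurable_funM => //; exact: measurable_RLk.
  - by move=> z; rewrite ler_wpM2l ?mulr_ge0 ?exprn_ge0// RLk_le.
move=> t /andP[t0 t1]; have [tp|tn] := ltP 0 t; last first.
  by rewrite ZE ?t0// RLI_le0// mulr0.
(* Since [RLk] of index alpha n + 1 is at most 1/Gamma(alpha n + 1), the iterated bounds are terms
   of a Mittag-Leffler series and decay geometrically. *)
have [C C0 HC] := Gamma_series_bound alpha 1 `|lambda| alpha1 ltr01 (normr_ge0 _).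
have Zn (n : nat) : `|Z t| <= M * C * 2^-1 ^+ n.
  rewrite -(on01E Z) ?tp//; apply: le_trans (bound n t) _.
  rewrite -!mulrA ler_wpM2l//; apply: le_trans (HC n).
  by rewrite ler_wpM2l ?exprn_ge0// RLk_le.
have c0 : (M * C * 2^-1 ^+ n) @[n --> \oo] --> (0 : R).
  rewrite -(mulr0 (M * C)); apply: cvgM; first exact: cvg_cst.
  by apply: cvg_expr; rewrite ger0_norm ?invr_ge0//; lra.
apply/eqP; rewrite -normr_le0 -(cvg_lim _ c0)//; apply: limr_ge; last exact: nearW.
by apply/cvg_ex; exists 0.
Qed.

Let RLI_rhs b V t : 0 < b -> C01 V ->
  RLI b (fun s => lambda * V s - y s) t = lambda * RLI b V t - RLI b y t.
Proof.
move=> b0 Vc; rewrite -(mulN1r (RLI b y t)) -RLI_lin//.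
by apply: eq_RLI => s _; rewrite mulN1r.
Qed.

(** V1 - V2 - (c1 - c2) e_alpha solves the homogeneous equation, so it is 0. Subtracting the two
    boundary conditions then leaves (c1 - c2) e_(alpha-1)(1) = 0. *)
Lemma integral_solution_unique c1 V1 c2 V2 :
  integral_solution c1 V1 -> integral_solution c2 V2 ->
  c1 * RLk (alpha - 1) 1 + RLI (alpha - 1) (fun s => lambda * V1 s - y s) 1 = 0 ->
  c2 * RLk (alpha - 1) 1 + RLI (alpha - 1) (fun s => lambda * V2 s - y s) 1 = 0 ->
  E (alpha - 1) 1 != 0 ->
  forall t, 0 <= t <= 1 -> V1 t = V2 t.
Proof.
move=> [V1c V1E] [V2c V2E] B1 B2 En0.
pose d := c1 - c2.
pose Z s := 1 * V1 s + (-1) * (1 * V2 s + d * E alpha s).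
have Wc : C01 (fun s => 1 * V2 s + d * E alpha s) by apply: C01D; exact: C01Z.
have Zc : C01 Z by apply: C01D; exact: C01Z.
have RZ b t : 0 < b ->
    RLI b Z t = RLI b V1 t - (RLI b V2 t + d * RLI b (E alpha) t).
  by move=> b0; rewrite RLI_lin// RLI_lin// !mul1r mulN1r.
have Z0 t : 0 <= t <= 1 -> Z t = 0.
  apply: RLI_eigenfunction0 => // s s01; have [_ s1] := andP s01.
  rewrite RZ// /Z V1E// V2E// ml_kernel_RLI// !RLI_rhs//.
  by rewrite /d; ring.
have RZ0 : RLI (alpha - 1) Z 1 = 0.
  rewrite (eq_RLI _ _ (fun s => 0 * y s + 0 * y s)); last first.
    by move=> s /andP[/ltW s0 s1]; rewrite Z0 ?s0// mul0r addr0.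
  by rewrite RLI_lin// !mul0r addr0.
have d0 : d * E (alpha - 1) 1 = 0.
  rewrite ml_kernel_RLI//; move: RZ0 B1 B2; rewrite RZ// !RLI_rhs// /d.
  move: (RLI _ V1 1) (RLI _ V2 1) (RLI _ y 1) (RLI _ (E alpha) 1) (RLk _ 1) => r1 r2 ry re k.
  move=> H1 H2 H3.
  have -> : (c1 - c2) * (k + lambda * re) =
    (c1 * k + (lambda * r1 - ry)) - (c2 * k + (lambda * r2 - ry))
      - lambda * (r1 - (r2 + (c1 - c2) * re)) by ring.
  by rewrite H1 H2 H3 mulr0 !subr0.
move: d0 => /eqP; rewrite mulf_eq0 (negbTE En0) orbF => /eqP d0.
move=> t t01; have := Z0 t t01; rewrite /Z d0 mul0r addr0 !mul1r mulN1r => /eqP.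
by rewrite subr_eq0 => /eqP.
Qed.

Definition ml_solution c t := c * E alpha t + (-1) * ml_conv alpha t.

Let ml_solution_c c : C01 (ml_solution c).
Proof. by apply: C01D; exact: C01Z. Qed.

(** One computation with two uses: [b = alpha] gives the integral equation, [b = alpha - 1] the
    boundary value. *)
Let RLI_ml_solution b c t : 0 < b -> t <= 1 ->
  c * RLk b t + RLI b (fun s => lambda * ml_solution c s - y s) t =
  c * E b t - ml_conv b t.
Proof.
move=> b0 t1; rewrite RLI_rhs// RLI_lin// ml_kernel_RLI// (ml_conv_RLI b t)//.
by ring.
Qed.

Lemma integral_solution_exists c : integral_solution c (ml_solution c).
Proof.
split=> // t /andP[t0 t1]; rewrite RLI_ml_solution// /ml_solution; ring.
Qed.

Lemma ml_solution_boundary c :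
  c * RLk (alpha - 1) 1 + RLI (alpha - 1) (fun s => lambda * ml_solution c s - y s) 1 =
  c * E (alpha - 1) 1 - ml_conv (alpha - 1) 1.
Proof. exact: RLI_ml_solution. Qed.

End integral_equation.

(** * The Green function *)

Section Green_function.
Context {R : realType}.
Local Notation mu := (@lebesgue_measure R).
Local Notation intg f := (mu.-integrable [set: R] (EFin \o f)).
Variables (alpha lambda : R) (y : R -> R).
Hypotheses (alpha_gt1 : 1 < alpha) (yc : C01 y).

Local Notation E := (ml_kernel alpha lambda).

Let alpha0 : 0 < alpha. Proof. exact: lt_trans alpha_gt1. Qed.
Let alpha1 : 1 <= alpha. Proof. exact: ltW. Qed.
Let am1 : 0 < alpha - 1. Proof. by rewrite subr_gt0. Qed.

Lemma ml_kernel_1 b : E b 1 = mittag_leffler alpha b lambda.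
Proof. by rewrite /ml_kernel on01E ?ltr01 ?lexx// !powR1 mul1r mulr1. Qed.

Let E_alpha x : 0 <= x <= 1 ->
  E alpha x = x `^ (alpha - 1) * mittag_leffler alpha alpha (lambda * x `^ alpha).
Proof.
move=> /andP[x0 x1]; have [xp|xn] := ltP 0 x; first by rewrite /ml_kernel on01E// xp.
have -> : x = 0 by lra.
by rewrite /ml_kernel on01_le0// powR0 ?mul0r// gt_eqF.
Qed.

(** The cases of the Green function disappear because the cut-off kernels vanish for nonpositive
    arguments; at [s = 1] this gives 0, the value chosen there. *)
Lemma GreenE t s : 0 <= t <= 1 -> 0 <= s <= 1 ->
  Green alpha lambda t s =
  E alpha t / E (alpha - 1) 1 * E (alpha - 1) (1 - s) - E alpha (t - s).
Proof.
move=> t01 s01; have [t0 t1] := andP t01; have [s0 s1] := andP s01.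
rewrite /Green; case: ifPn => [s1'|]; last first.
  rewrite -leNgt => s1'; have -> : s = 1 by lra.
  rewrite subrr [E (alpha - 1) 0]on01_le0// [E alpha (t - 1)]on01_le0 ?subr_le0//.
  by rewrite mulr0 subrr.
have -> : E (alpha - 1) (1 - s) = (1 - s) `^ (alpha - 1 - 1) *
    mittag_leffler alpha (alpha - 1) (lambda * (1 - s) `^ alpha).
  by rewrite /ml_kernel on01E//; lra.
have -> : (1 - s) `^ (alpha - 1 - 1) = ((1 - s) `^ (2 - alpha))^-1.
  by rewrite -powRN; congr (_ `^ _); ring.
rewrite -E_alpha// ml_kernel_1.
have -> : E alpha t * mittag_leffler alpha (alpha - 1) (lambda * (1 - s) `^ alpha) /
   ((1 - s) `^ (2 - alpha) * mittag_leffler alpha (alpha - 1) lambda) =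
   E alpha t / mittag_leffler alpha (alpha - 1) lambda *
   (((1 - s) `^ (2 - alpha))^-1 *
    mittag_leffler alpha (alpha - 1) (lambda * (1 - s) `^ alpha)).
  rewrite invfM.
  move: (_^-1) (_^-1) (mittag_leffler _ _ (_ * _)) (E _ _) => a b c d; ring.
case: ifPn => [st|]; first by rewrite -E_alpha//; lra.
rewrite -ltNge => ts; by rewrite [E alpha (t - s)]on01_le0 ?subr0// subr_le0 ltW.
Qed.

Lemma Green_integral t : 0 <= t <= 1 ->
  \int[mu]_(s in `[0, 1]) (Green alpha lambda t s * y s) =
  ml_solution alpha lambda y (ml_conv alpha lambda y (alpha - 1) 1 / E (alpha - 1) 1) t.
Proof.
move=> t01; have [t0 t1] := andP t01.
have [M M0 yM] := C01_on01_bounded _ yc.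
have my := measurable_C01 _ yc.
have iE b x : 0 < b -> intg (fun s => E b (x - s) * on01 y s).
  by move=> b0; apply: (integrable_conv _ _ M) => //; exact: integrable_ml_kernel.
pose k := E alpha t / E (alpha - 1) 1.
pose F s := k * (E (alpha - 1) (1 - s) * on01 y s) - E alpha (t - s) * on01 y s.
have ik : intg (fun s => k * (E (alpha - 1) (1 - s) * on01 y s)).
  exact: (@integrableZl _ _ _ mu setT measurableT k _ (iE (alpha - 1) 1 am1)).
have iF : intg F by exact: (@integrableB _ _ _ mu setT measurableT _ _ ik (iE alpha t alpha0)).
have FE s : 0 < s <= 1 -> Green alpha lambda t s * y s = F s.
  move=> /andP[s0 s1]; rewrite GreenE ?(ltW s0)// /F on01E ?s0// /k.
  move: (E _ _ / _) (E _ (1 - s)) (E _ (t - s)) => a b c; ring.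
(* The point 0 is dropped because [on01 y] is 0 there and [y] need not be. *)
rewrite -Rintegral_itv_obnd_cbnd; last first.
  have : mu.-integrable `]0, 1] (EFin \o F) by exact: integrableS iF.
  apply: eq_integrable => // s; rewrite inE/= in_itv/= => s01.
  by rewrite FE.
transitivity (\int[mu]_s F s).
  rewrite Rintegral_mkcond; apply: eq_Rintegral => s _; rewrite patchE.
  case: ifPn => [|/negP]; rewrite inE/= in_itv/=; first exact: FE.
  move=> /negP s01; have O : on01 y s = 0.
    have [s0|s0] := leP s 0; first by rewrite on01_le0.
    by rewrite on01_gt1//; move: s01; rewrite s0/= -ltNge.
  have aux (a b c : R) : a * (b * 0) - c * 0 = 0 by ring.
  by rewrite /F O aux.
rewrite RintegralB//; last exact: iE.
rewrite RintegralZl//; last exact: iE.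
have aux (e d a b : R) : e / d * a - b = a / d * e + (-1) * b by ring.
exact: aux.
Qed.

End Green_function.

(** * From the boundary value problem to the integral equation *)

Section solution_integral_equation.
Context {R : realType}.
Local Notation I := (`]0, 1]%classic : set R).
Implicit Types (f : R -> R) (a b l t s : R).

Variables (alpha lambda : R) (y u : R -> R).
Hypotheses (alpha_gt1 : 1 < alpha) (alpha_le2 : alpha <= 2) (yc : C01 y).
Hypothesis usol : is_solution alpha lambda y u.

Let alpha0 : 0 < alpha. Proof. exact: lt_trans alpha_gt1. Qed.
Let am1 : 0 < alpha - 1. Proof. by rewrite subr_gt0. Qed.

Let inI t : 0 < t <= 1 -> I t. Proof. by move=> t01; rewrite /= in_itv. Qed.

Let I01 : I `<=` `[0, 1].
Proof. by move=> t; rewrite /= !in_itv/= => /andP[/ltW -> ->]. Qed.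

(* [u 0] is unconstrained, whereas the limit of [u] at 0 will turn out to be 0. *)
Let V t := if 0 < t then u t else 0.

Let uV t : 0 < t <= 1 -> u t = V t. Proof. by move=> /andP[t0 _]; rewrite /V t0. Qed.

Let V0 : V 0 = 0. Proof. by rewrite /V ltxx. Qed.

(** Away from 0, V is t^(alpha-2) w. The limit condition gives w(0) = 0, so near 0 V is t^(alpha-1)
    times a difference quotient of w, which converges as w is differentiable at 0. *)
Let Vc : C01 V.
Proof.
have [[w [[wd _] wu]] _ lim0 _] := usol.
have wE t : 0 < t <= 1 -> w t = t `^ (2 - alpha) * u t.
  by move=> t01; apply: wu; rewrite in_itv.
have hdw t : 0 <= t <= 1 -> has_derivative_in `[0, 1] w t (derive_in `[0, 1] w t).
  by move=> t01; apply: wd; rewrite /= in_itv.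
have wc : C01 w by move=> t t01; exact: has_derivative_in_cvg (hdw t t01).
have o01 : 0 <= (0 : R) <= 1 by rewrite lexx ler01.
have w0 : w 0 = 0.
  have wr := cvg_within01_at_right _ _ (wc 0 o01).
  apply: (cvg_unique _ wr) => //; move: lim0; apply: cvg_trans; apply: near_eq_cvg.
  by apply: near_at_right01 => s s01; rewrite /= wE.
have VE t : 0 < t <= 1 -> V t = t `^ (alpha - 2) * w t.
  move=> t01; have [t0 _] := andP t01; rewrite wE// mulrA -powRD ?(gt_eqF t0) ?implybT//.
  rewrite (_ : alpha - 2 + (2 - alpha) = 0); last by ring.
  by rewrite powRr0 mul1r uV.
move=> t t01; have [t0 t1] := andP t01.
have [->|tn0] := eqVneq t 0.
  rewrite V0.
  pose phi s := s `^ (alpha - 1) * ((w s - w 0) / (s - 0)).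
  have phi0 : phi s @[s --> within `[0, 1] (0 : R)^'] --> (0 : R).
    rewrite [X in _ --> X](_ : _ = 0 * derive_in `[0, 1] w 0); last by rewrite mul0r.
    apply: cvgM; last exact: hdw.
    by apply: cvg_within_dnbhs; exact: powR_cvg_within0.
  move=> P P0; have HP : nbhs (0 : R) (fun s => s != 0 -> `[0, 1]%classic s -> P (phi s)).
    exact: (phi0 P P0).
  change (nbhs (0 : R) (fun s => `[0, 1]%classic s -> P (V s))).
  apply: (@filterS _ (nbhs (0 : R)) _ _ _ _ HP) => s Ps s01.
  have [->|sn0] := eqVneq s 0; first by rewrite V0; exact: nbhs_singleton.
  have [s0 s1] : 0 <= s /\ s <= 1 by move: s01; rewrite /= in_itv/= => /andP[].
  have sp : 0 < s by rewrite lt_def sn0.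
  have -> : V s = phi s; last exact: Ps.
  rewrite VE ?sp// /phi w0 !subr0 mulrCA mulrC; congr (_ * _).
  have -> : s `^ (alpha - 1) = s `^ (alpha - 2) * s.
    rewrite -{3}(powRr1 s0) -powRD ?sn0 ?implybT//; congr (_ `^ _); ring.
  by rewrite mulfK.
have tp : 0 < t by rewrite lt_def tn0.
rewrite VE ?tp//.
have : s `^ (alpha - 2) * w s @[s --> within `[0, 1] (nbhs t)] --> t `^ (alpha - 2) * w t.
  by apply: cvgM; [apply: cvg_within_filter; exact: continuous_powR|exact: wc].
apply: cvg_trans; apply: near_eq_cvg.
change (nbhs t (fun s => `[0, 1]%classic s -> s `^ (alpha - 2) * w s = V s)).
apply: (@filterS _ (nbhs t) _ (fun s => 0 < s)); last exact: lt_nbhsr.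
by move=> s s0; rewrite /= in_itv/= => /andP[_ s1]; rewrite VE// s0.
Qed.

Let g s := lambda * V s - y s.

Let gc : C01 g. Proof. by apply: C01B => //; exact: C01Z. Qed.

Let D k := iter k (derive_in I) (RL_integral alpha u).

Let hdD k t : (k < RL_order alpha)%N -> 0 < t <= 1 ->
  has_derivative_in I (D k) t (D k.+1 t).
Proof.
move=> kn t01; have [_ [RLd _] _ _] := usol.
by apply: derivable_inE; apply: RLd => //; exact: inI.
Qed.

Let D_order t : 0 < t <= 1 -> D (RL_order alpha) t = g t.
Proof.
move=> t01; have [_ [_ RLe] _ _] := usol.
have : RL_derive I alpha u t - lambda * u t + y t = 0 by apply: RLe; rewrite in_itv.
rewrite /RL_derive -/(D _ t) /g -uV//.
by move: (D _ t) => d H; apply/eqP; rewrite -subr_eq0 opprB addrCA addrA -opprB; apply/eqP; lra.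
Qed.

Let affine0 f a b : C01 f -> f 0 = 0 -> (forall t, 0 < t <= 1 -> f t = a * t + b) -> b = 0.
Proof.
move=> fc f0 fE; have o01 : 0 <= (0 : R) <= 1 by rewrite lexx ler01.
have fr := cvg_within01_at_right _ _ (fc 0 o01); rewrite f0 in fr.
have : (a * t + b) @[t --> (0 : R)^'+] --> a * 0 + b.
  apply: cvgD; last exact: cvg_cst.
  apply: cvgM; first exact: cvg_cst.
  by apply: cvg_at_right_filter; exact: cvg_id.
rewrite mulr0 add0r => br; apply: (cvg_unique _ _ fr) => //; move: br.
apply: cvg_trans; apply: near_eq_cvg.
by apply: near_at_right01 => s s01; rewrite /= fE.
Qed.

(** [f] minus [RLI 2 g] has second derivative 0 on []0, 1]], hence is affine; its value 0 at 0
    removes the constant term. *)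
Let affine f p1 : C01 f -> f 0 = 0 ->
  (forall t, 0 < t <= 1 -> has_derivative_in I f t (p1 t)) ->
  (forall t, 0 < t <= 1 -> has_derivative_in I p1 t (g t)) ->
  exists a, forall t, 0 <= t <= 1 -> f t = a * RLk 2 t + RLI 2 g t.
Proof.
move=> fc f0 hf hp1.
have hq t : 0 < t <= 1 -> has_derivative_in I (fun s => f s - RLI 2 g s) t (p1 t - RLI 1 g t).
  move=> t01; apply: has_derivative_inB; first exact: hf.
  by rewrite (mulr2n 1); apply: RLI_has_derivative => //; exact: inI.
have hq1 t : 0 < t <= 1 -> has_derivative_in I (fun s => p1 s - RLI 1 g s) t 0.
  move=> t01; have := has_derivative_inB _ _ _ _ _ _ (hp1 t t01)
    (RLI1_has_derivative I g t I01 gc (inI t t01)).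
  by rewrite subrr.
pose a := p1 1 - RLI 1 g 1; pose b := f 1 - RLI 2 g 1 - a.
have fE t : 0 < t <= 1 -> f t - RLI 2 g t = a * t + b.
  exact: (has_derivative_in_affine _ _ hq hq1).
have b0 : b = 0.
  apply: (affine0 (fun s => f s - RLI 2 g s) a) => //.
    by apply: C01B => //; exact: continuous_RLI.
  by rewrite f0 RLI_le0// subrr.
exists a => t t01; have [t0 t1] := andP t01; rewrite RLk2//.
have [tp|tn] := ltP 0 t.
  by have := fE t; rewrite tp t1 b0 addr0 => /(_ isT) <-; rewrite subrK.
have -> : t = 0 by lra.
by rewrite f0 RLI_le0// mulr0 addr0.
Qed.

Lemma solution_integral_equation :
  exists c, integral_solution alpha lambda y c V.
Proof.
have b0 : 0 < (RL_order alpha)%:R - alpha.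
  have [a2|a2] := ltrP alpha 2; first by rewrite RL_order_lt2// subr_gt0.
  have a2' : alpha = 2 by apply/eqP; rewrite eq_le alpha_le2.
  by rewrite (RL_order_2 _ a2') a2'; lra.
have D0 t : 0 < t <= 1 -> D 0 t = RLI ((RL_order alpha)%:R - alpha) V t.
  by move=> t01; rewrite /D /= /RL_integral (integral_RLI _ V u t b0 Vc t01 uV).
have [a2|a2] := ltrP alpha 2; last first.
  have {}a2 : alpha = 2 by apply/eqP; rewrite eq_le alpha_le2.
  have n3 := RL_order_2 _ a2.
  have e1 : 1 = (RL_order alpha)%:R - alpha by rewrite n3 a2; lra.
  (* For alpha = 2 the first of the three derivatives only undoes [RLI 1]. *)
  have D1 t : 0 < t <= 1 -> D 1 t = V t.
    move=> t01; have [t0 t1] := andP t01.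
    have h1 : has_derivative_in I (RLI 1 V) t (D 1 t).
      apply: (@eq_has_derivative_in _ _ (D 0)); [exact: inI| |by apply: hdD; rewrite ?n3].
      move=> s sI; have s01 : 0 < s <= 1 by move: sI; rewrite /= in_itv.
      by rewrite (D0 s s01) -e1.
    apply: (has_derivative_in_unique I t _ _ (RLI 1 V)) => //; first by rewrite (ltW t0).
    by apply: RLI1_has_derivative => //; exact: inI.
  have [a VE] : exists a, forall t, 0 <= t <= 1 -> V t = a * RLk 2 t + RLI 2 g t.
    apply: (affine V (D 2)) => // t t01.
      apply: (@eq_has_derivative_in _ _ (D 1)); [exact: inI| |by apply: hdD; rewrite ?n3].
      by move=> s sI; apply: D1; move: sI; rewrite /= in_itv.
    have := hdD 2 t; rewrite n3 => /(_ isT t01).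
    by have := D_order t t01; rewrite n3 => ->.
  exists a; split; first exact: Vc.
  by move=> t t01; rewrite a2; exact: VE.
have n2 := RL_order_lt2 _ alpha_gt1 a2.
have two0 : 0 < (2 : R) by exact: ltr0n.
have b20 : 0 < 2 - alpha by rewrite subr_gt0.
have [a FE] : exists a, forall t, 0 <= t <= 1 ->
    RLI (2 - alpha) V t = a * RLk 2 t + RLI 2 g t.
  apply: (affine _ (D 1)).
  - exact: continuous_RLI.
  - exact: RLI_le0.
  - move=> t t01; apply: (@eq_has_derivative_in _ _ (D 0)); [exact: inI| |by apply: hdD; rewrite ?n2].
    by move=> s sI; rewrite -n2; apply: D0; move: sI; rewrite /= in_itv.
  - move=> t t01; have := hdD 1 t; rewrite n2 => /(_ isT t01).
    by have := D_order t t01; rewrite n2 => ->.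
exists a; split; first exact: Vc.
move=> t t01; have [t0 t1] := andP t01.
have [tp|tn] := ltP 0 t; last first.
  have -> : t = 0 by lra.
  by rewrite V0 RLk_le0// RLI_le0// mulr0 addr0.
(* [U] is the expected right side. [RLI (alpha - 1)] applied to [FE] gives equal integrals of [U]
   and [V], and both are continuous, so differentiating gives [V t = U t]. *)
pose U s := a * RLk alpha s + 1 * RLI alpha g s.
have Kc : C01 (RLk alpha) by exact: continuous_RLk.
have K2c : C01 (RLk (2 : R)) by apply: continuous_RLk; lra.
have Uc : C01 U by apply: C01D; apply: C01Z => //; exact: continuous_RLI.
have e1 : alpha - 1 + (2 - alpha) = 1 by ring.
have e2 : alpha - 1 + 2 = 1 + alpha by ring.
have UV s : s <= 1 -> RLI 1 U s = RLI 1 V s.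
  move=> s1; rewrite /U (RLI_lin 1 a 1 _ _ s ltr01 Kc (continuous_RLI _ _ alpha0 gc)).
  rewrite (RLI_RLk 1 alpha s ltr01 alpha0 s1) (RLI_RLI 1 alpha g s ltr01 alpha0 gc s1).
  transitivity (RLI (alpha - 1) (RLI (2 - alpha) V) s); last first.
    by rewrite (RLI_RLI _ _ _ _ am1 b20 Vc s1) e1.
  transitivity (RLI (alpha - 1) (fun x => a * RLk 2 x + 1 * RLI 2 g x) s); last first.
    by apply: eq_RLI => x /andP[/ltW x0 x1]; rewrite FE ?x0// mul1r.
  rewrite (RLI_lin _ a 1 _ _ s am1 K2c (continuous_RLI _ _ two0 gc)).
  by rewrite (RLI_RLk _ _ s am1 two0 s1) (RLI_RLI _ _ g s am1 two0 gc s1) e2.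
suff : V t = U t by rewrite /U mul1r.
have It : I t by apply: inI; rewrite tp.
have hV : has_derivative_in I (RLI 1 V) t (V t) by exact: RLI1_has_derivative.
have hU : has_derivative_in I (RLI 1 V) t (U t).
  apply: (@eq_has_derivative_in _ _ (RLI 1 U)); [exact: It| |exact: RLI1_has_derivative].
  by move=> s; rewrite /= in_itv/= => /andP[_ s1]; exact: UV.
exact: (has_derivative_in_unique I t _ t01 _ _ _ hV hU).
Qed.

End solution_integral_equation.

Theorem theorem6 (R : realType) (y : R -> R) (alpha lambda : R)
    (y_cont : {within `[0, 1], continuous y})
    (alpha_gt1 : 1 < alpha) (alpha_le2 : alpha <= 2)
    (E_neq0 : mittag_leffler alpha (alpha - 1) lambda <> 0) :
  exists u : R -> R,
    [/\ is_solution alpha lambda y u,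
        (forall v : R -> R, is_solution alpha lambda y v ->
           forall t : R, t \in `]0, 1] -> v t = u t)
      & (forall t : R, t \in `[0, 1] ->
           u t = \int[lebesgue_measure]_(s in `[0, 1])
                   (Green alpha lambda t s * y s))].
Proof.
have yc : C01 y by exact/C01P.
have En0 : ml_kernel alpha lambda (alpha - 1) 1 != 0 by rewrite ml_kernel_1; exact/eqP.
pose c := ml_conv alpha lambda y (alpha - 1) 1 / ml_kernel alpha lambda (alpha - 1) 1.
pose V := ml_solution alpha lambda y c.
have Vsol : integral_solution alpha lambda y c V by exact: integral_solution_exists.
have Vbc : c * RLk (alpha - 1) 1 + RLI (alpha - 1) (fun s => lambda * V s - y s) 1 = 0.
  by rewrite ml_solution_boundary// /c divfK// subrr.
pose u (t : R) := \int[lebesgue_measure]_(s in `[0, 1]) (Green alpha lambda t s * y s).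
have uV01 t : 0 <= t <= 1 -> u t = V t by move=> t01; exact: Green_integral.
have uV t : 0 < t <= 1 -> u t = V t.
  by move=> /andP[t0 t1]; apply: uV01; rewrite ltW.
have I1 : 0 <= (1 : R) <= 1 by rewrite ler01 lexx.
exists u; split => //.
- have [uRL uE] := integral_solution_RL _ _ _ alpha_gt1 alpha_le2 yc _ _ _ Vsol uV.
  split.
  + exact: integral_solution_C1 Vsol uV.
  + split=> // t; rewrite in_itv/= => t01; rewrite uE//; ring.
  + exact: integral_solution_lim0 Vsol uV.
  + have := integral_solution_derive1 _ _ _ alpha_gt1 yc _ _ _ Vsol uV.
    by rewrite Vbc; exact: has_derivative_inE.
- move=> v vsol t; rewrite in_itv/= => /andP[t0 t1].
  have [d Wsol] := solution_integral_equation _ _ _ _ alpha_gt1 alpha_le2 yc vsol.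
  (* [W] is [v] with the value 0 at nonpositive arguments; the derivative at 1 relative to []0, 1]]
     does not see the change. *)
  set W := fun x => _ in Wsol.
  have vW x : 0 < x <= 1 -> v x = W x by move=> /andP[x0 _]; rewrite /W x0.
  have hW := integral_solution_derive1 _ _ _ alpha_gt1 yc _ _ _ Wsol vW.
  have Wbc : d * RLk (alpha - 1) 1 + RLI (alpha - 1) (fun s => lambda * W s - y s) 1 = 0.
    have [_ _ _ [vd v0]] := vsol.
    rewrite -v0; apply: (has_derivative_in_unique _ 1 _ I1 v _ _ hW) => //.
  have t01 : 0 <= t <= 1 by rewrite t1 ltW.
  rewrite vW ?t0// uV01//.
  exact: (integral_solution_unique _ _ _ alpha_gt1 yc _ _ _ _ Wsol Vsol Wbc Vbc En0 t t01).
Qed.
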